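(* Let $\mathcal B$ be a C*-algebra, let $\mathcal H$ be a complex Hilbert space and let $\gamma:\mathcal H\to\mathcal B^{\dagger}_+$ be a map. Then there exists a positive linear map $\Phi:\mathcal B\to B(\mathcal H)$ such that $\gamma(h)(b)=\langle\Phi(b)h,h\rangle$ for every $b\in\mathcal B$ and every $h\in\mathcal H$ if and only if all of the following hold: (1) $\gamma(\lambda h)=|\lambda|^2\gamma(h)$ for every $\lambda\in\mathbb C$ and every $h\in\mathcal H$; (2) there is a constant $C$ such that $\|\gamma(h)\|\le C\|h\|^2$ for every $h\in\mathcal H$; (3) $\gamma(h+k)+\gamma(h-k)=2\gamma(h)+2\gamma(k)$ for every $h,k\in\mathcal H$. Moreover, if $\mathcal B$ is unital, then $\Phi$ is unital if and only if $\gamma(h)$ is a state for every $h\in\mathcal H$ with $\|h\|=1$.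
   Context: $\mathcal B^{\dagger}_+$ denotes the set of positive linear functionals on $\mathcal B$. The map $\gamma$ is an arbitrary function (not assumed linear). *)

(* Defs.v *)
From HB Require Import structures.
From mathcomp Require Import all_boot all_order all_algebra.
From mathcomp Require Import all_classical all_reals all_analysis.
From mathcomp Require Import complex.

Set Implicit Arguments.
Unset Strict Implicit.
Unset Printing Implicit Defensive.

Import Order.TTheory GRing.Theory Num.Theory.
Import numFieldNormedType.Exports.

Local Open Scope classical_set_scope.
Local Open Scope ring_scope.

(* The field of complex numbers is R[i] with R : realType; norms on normed
   modules over R[i] take values in R[i] (and are real, nonnegative there). *)

(* The inner product is linear in its first argument. *)
HB.mixin Record CompleteNormedModule_isHilbert (R : realType) H
    of CompleteNormedModule R[i] H := {
  inner : {dot H for (@Num.conj R[i])} ;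
  inner_normE : forall h : H, inner h h = `|h| ^+ 2
}.

#[short(type="hilbertType")]
HB.structure Definition Hilbert (R : realType) :=
  { H of CompleteNormedModule R[i] H & CompleteNormedModule_isHilbert R H }.

(* No unit is assumed, so the multiplication cannot come from a ring
   structure of the library. *)
HB.mixin Record CompleteNormedModule_isCstarAlgebra (R : realType) B
    of CompleteNormedModule R[i] B := {
  cmul : {bilinear B -> B -> B} ;
  cstar : B -> B ;
  cmulA : associative (cmul : B -> B -> B) ;
  cnormM : forall a b : B, `|cmul a b| <= `|a| * `|b| ;
  cstarD : {morph cstar : a b / a + b} ;
  cstarZ : forall (z : R[i]) (a : B), cstar (z *: a) = z^* *: cstar a ;
  cstarM : forall a b : B, cstar (cmul a b) = cmul (cstar b) (cstar a) ;
  cstarK : involutive cstar ;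
  cnorm_star_mul : forall a : B, `|cmul (cstar a) a| = `|a| ^+ 2
}.

#[short(type="cstarAlgType")]
HB.structure Definition CstarAlgebra (R : realType) :=
  { B of CompleteNormedModule R[i] B &
         CompleteNormedModule_isCstarAlgebra R B }.

Section Cstar.
Context {R : realType} {B : cstarAlgType R}.

Definition is_unit (e : B) : Prop :=
  forall b : B, cmul e b = b /\ cmul b e = b.

Definition cpositive (a : B) : Prop := exists b : B, a = cmul (cstar b) b.

End Cstar.

Record posFunctional (R : realType) (B : cstarAlgType R) := PosFunctional {
  posfun :> {scalar B} ;
  posfun_ge0 : forall a : B, cpositive a -> 0 <= posfun a
}.

(* Extended-real valued, so that finiteness is not built into the definition. *)
Definition functional_norm (R : realType) (B : cstarAlgType R)
    (f : B -> R[i]) : \bar R :=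
  ereal_sup [set (complex.Re `|f b|)%:E | b in [set b : B | `|b| <= 1]].

Definition is_state (R : realType) (B : cstarAlgType R)
    (f : posFunctional B) : Prop :=
  functional_norm f = 1%E.

Section BoundedOperators.
Context {R : realType} (H : hilbertType R).

Definition bounded_operator : {pred H -> H} := fun T =>
  `[< linear T /\ exists M : R[i], forall h : H, `|T h| <= M * `|h| >].

Lemma bounded_operator_submod_closed : submod_closed bounded_operator.
Proof.
split.
  apply/asboolP; split=> [a x y|]; first by rewrite scaler0 add0r.
  by exists 0 => h; rewrite normr0 mul0r.
move=> a S T /asboolP[linS [M SM]] /asboolP[linT [N TN]].
apply/asboolP; split=> [b x y|].
  rewrite /= !fctE linS linT !scalerDr !scalerA (mulrC a b).
  by rewrite addrACA.
exists (`|a| * M + N) => h; rewrite /= !fctE.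
rewrite (le_trans (ler_normD _ _))// mulrDl lerD// normrZ -mulrA.
by rewrite ler_wpM2l.
Qed.

HB.instance Definition _ := GRing.isSubmodClosed.Build R[i] (H -> H)
  bounded_operator bounded_operator_submod_closed.

Record boundedOp := BoundedOp {
  bop_fun :> H -> H ;
  bop_bounded : bop_fun \in bounded_operator
}.

HB.instance Definition _ := [isSub for bop_fun].
HB.instance Definition _ := [Choice of boundedOp by <:].
HB.instance Definition _ := [SubChoice_isSubLmodule of boundedOp by <:].

Definition op_positive (T : boundedOp) : Prop :=
  forall h : H, 0 <= inner (T h) h.

End BoundedOperators.

Definition positive_map (R : realType) (B : cstarAlgType R)
    (H : hilbertType R) (Phi : B -> boundedOp H) : Prop :=
  forall a : B, cpositive a -> op_positive (Phi a).

(* Main.v *)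
Require Import Defs.
From HB Require Import structures.
From mathcomp Require Import all_boot all_order all_algebra.
From mathcomp Require Import all_classical all_reals all_analysis.
From mathcomp Require Import complex ring lra.

Import Order.TTheory GRing.Theory Num.Theory.
Import numFieldNormedType.Exports.
Local Open Scope ring_scope.

(** Given Phi, the conditions on gamma are computations with the inner
    product, except for the constant in the norm bound. Each operator Phi b is
    bounded, so the functionals gamma h with h in the unit ball are bounded at
    each point b; what is to be shown is that pointwise bounded families of
    positive functionals are uniformly bounded (posfun_uniform_bound). If not,
    there are positive p_n of bounded norm at which some members of the family
    are larger than n 2^(n+1), and the family is then unbounded at the sum of
    the p_n / 2^(n+1), which dominates each term.

    Positive here means of the form b* b, and the argument needs that the tails
    of this series are positive and that every element is a combination of
    positive ones. Both are obtained without spectral theory from the set of the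
    self-adjoint x such that multiplication by 1 - x is a contraction
    (pos_le2). This set is visibly closed and convex; it contains the squares
    of self-adjoint elements of norm less than 1 (pos_le2_sq), its elements
    have square roots in it (pos_le2_sqrt), and it contains (c + h) / 2 and
    (c - h) / 2 when c is the square root of h h (selfadj_decomp).

    Conversely, for fixed b the map h -> gamma h b is a bounded quadratic form.
    Its polarization is additive by the parallelogram law (diff_formDl),
    homogeneous for the reals by boundedness (diff_formZl) and sesquilinear by
    invariance under multiplication by i, so the Riesz representation theorem
    (riesz) turns it into an operator. The polarization is linear in the form,
    so the operator is linear in b.

    In a unital algebra e - h is positive for h self-adjoint of norm at most 1,
    whence the norm of a positive functional is its value at the unit e. Thus
    gamma h is a state for all unit vectors h if and only if Phi e and the
    identity have the same quadratic form, which by polarization determines an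
    operator. *)

Set Implicit Arguments.
Unset Strict Implicit.
Unset Printing Implicit Defensive.

Local Notation "x %:C" := (real_complex _ x) : ring_scope.
Local Notation iu := (Complex 0 1).

(** * Real-valued norms and rates of convergence *)

Section RealNorm.
Context {R : realType} {V : normedModType R[i]}.

(** The norm has values in R[i]; estimates are made in R, where the
    order is total. *)
Definition rnorm (x : V) : R := complex.Re `|x|.

Lemma rnormE x : `|x| = (rnorm x)%:C.
Proof. by rewrite /rnorm RRe_real ?normr_real. Qed.

Lemma rnorm_ge0 x : 0 <= rnorm x.
Proof. by rewrite -lecR -rnormE rmorph0 normr_ge0. Qed.

Lemma ler_rnormD x y : rnorm (x + y) <= rnorm x + rnorm y.
Proof. by have := ler_normD x y; rewrite !rnormE -rmorphD lecR. Qed.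

Lemma rnormN x : rnorm (- x) = rnorm x.
Proof. by rewrite /rnorm normrN. Qed.

Lemma rnormBC x y : rnorm (x - y) = rnorm (y - x).
Proof. by rewrite /rnorm distrC. Qed.

Lemma rnorm0 : rnorm 0 = 0.
Proof. by rewrite /rnorm normr0. Qed.

Lemma rnorm_eq0 x : rnorm x = 0 -> x = 0.
Proof. by move=> x0; apply/eqP; rewrite -normr_eq0 rnormE x0. Qed.

Lemma rnormZr (s : R) x : rnorm (s%:C *: x) = `|s| * rnorm x.
Proof.
apply: complexI; rewrite -rnormE normrZ rnormE rmorphM /=; congr (_ * _).
by rewrite normc_def /= expr0n addr0 sqrtr_sqr.
Qed.

Lemma rnormZi x : rnorm (iu *: x) = rnorm x.
Proof.
apply: complexI; rewrite -rnormE normrZ rnormE.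
by rewrite normc_def /= expr0n add0r expr1n sqrtr1 mul1r.
Qed.

Lemma ler_rnormB x y : rnorm (x - y) <= rnorm x + rnorm y.
Proof. by rewrite -(rnormN y) ler_rnormD. Qed.

End RealNorm.

Section ComplexModulus.
Context {R : realType}.
Implicit Types z w : R[i].

Definition cabs z : R := complex.Re `|z|.

Lemma cabsE z : `|z| = (cabs z)%:C.
Proof. by rewrite /cabs RRe_real ?normr_real. Qed.

Lemma cabs_ge0 z : 0 <= cabs z.
Proof. by rewrite -lecR -cabsE rmorph0 normr_ge0. Qed.

Lemma ler_cabsD z w : cabs (z + w) <= cabs z + cabs w.
Proof. by have := ler_normD z w; rewrite !cabsE -rmorphD lecR. Qed.

Lemma cabsN z : cabs (- z) = cabs z.
Proof. by rewrite /cabs normrN. Qed.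

Lemma ler_cabsB z w : cabs (z - w) <= cabs z + cabs w.
Proof. by rewrite -(cabsN w) ler_cabsD. Qed.

Lemma cabsM z w : cabs (z * w) = cabs z * cabs w.
Proof. by apply: complexI; rewrite rmorphM -!cabsE normrM. Qed.

Lemma cabs_real (s : R) : cabs s%:C = `|s|.
Proof. by rewrite /cabs normc_def /= expr0n addr0 sqrtr_sqr. Qed.

Lemma cabs_i : cabs iu = 1.
Proof. by rewrite /cabs normc_def /= expr0n add0r expr1n sqrtr1. Qed.

Lemma cabs_Re z : complex.Re z <= cabs z.
Proof.
have := normc_ge_Re z; rewrite cabsE lecR; apply: le_trans; exact: ler_norm.
Qed.

Lemma ge0_cabs z : 0 <= z -> z = (cabs z)%:C.
Proof. by move=> z0; rewrite -cabsE ger0_norm. Qed.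

Lemma ler_cabs z w : 0 <= z -> z <= w -> cabs z <= cabs w.
Proof.
by move=> z0 zw; rewrite -lecR -!cabsE !ger0_norm // (le_trans z0).
Qed.

End ComplexModulus.

(** All limits below are taken at an explicit rate of the form c / (n + 1). *)
Section Rates.
Context {R : realType}.

Lemma ler_rate (a b c : R) :
  (forall n : nat, a <= b + c / n.+1%:R) -> a <= b.
Proof.
move=> ab; rewrite leNgt; apply/negP => ba.
have d0 : 0 < a - b by rewrite subr_gt0.
have [n nc] : exists n : nat, c / (a - b) < n.+1%:R.
  exists (Num.trunc `|c / (a - b)|).
  by rewrite (le_lt_trans (ler_norm _)) // truncnS_gt.
have := ab n; rewrite -lerBlDl leNgt => /negP; apply.
by rewrite ltr_pdivrMr ?ltr0n // mulrC -ltr_pdivrMr.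
Qed.

Lemma bernoulli (s : R) n : 0 <= s -> 1 + n%:R * s <= (1 + s) ^+ n.
Proof.
move=> s0; elim: n => [|n IHn]; first by rewrite mul0r addr0 expr0.
rewrite exprS -natr1; have n0 : 0 <= n%:R :> R by [].
have := ler_wpM2l s0 IHn; have := mulr_ge0 n0 (sqr_ge0 s); lra.
Qed.

Lemma eq_rate {V : normedModType R[i]} (x y : V) (c : R) :
  (forall n : nat, rnorm (x - y) <= c / n.+1%:R) -> x = y.
Proof.
move=> xy; apply/subr0_eq/rnorm_eq0/le_anti; rewrite rnorm_ge0 andbT.
by apply: (@ler_rate _ _ c) => n; rewrite add0r.
Qed.

Lemma complete_rate {V : completeNormedModType R[i]} (u : nat -> V) (c : R) :
  (forall n m, (n <= m)%N -> rnorm (u m - u n) <= c / n.+1%:R) ->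
  exists l, forall n, rnorm (u n - l) <= c / n.+1%:R.
Proof.
move=> uc.
have c0 : 0 <= c.
  by have := uc 0%N 0%N isT; rewrite subrr rnorm0 divr1.
have small (e : R) : 0 < e -> exists n : nat, c / n.+1%:R < e.
  move=> e0; apply/not_existsP => H.
  have : e <= 0; last by rewrite leNgt e0.
  by apply: (@ler_rate _ _ c) => n; rewrite add0r leNgt; apply/negP/H.
have cvgu : cvg (u @ \oo)%classic.
  apply: cauchy_cvg; apply: cauchy_exP => e e0.
  have eE : e = (complex.Re e)%:C by rewrite RRe_real // gtr0_real.
  have [n nce] : exists n : nat, c / n.+1%:R < complex.Re e.
    by apply: small; rewrite -ltcR -eE.
  exists (u n); exists n => // m /= nm.
  rewrite -ball_normE /= distrC rnormE eE ltcR.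
  exact: le_lt_trans (uc _ _ nm) nce.
exists (lim (u @ \oo)%classic) => n.
apply: (@ler_rate _ _ 1) => k.
have k0 : 0 < (k.+1%:R^-1 : R)%:C by rewrite ltcR invr_gt0 ltr0n.
have /cvgrPdist_lt/(_ _ k0)[m _ mP] := cvgu.
have nM : (n <= maxn n m)%N by rewrite leq_maxl.
have mM : (m <= maxn n m)%N by rewrite leq_maxr.
have := mP _ mM; rewrite /= rnormE ltcR => /ltW lk.
rewrite -(subrK (u (maxn n m)) (u n)) -addrA.
rewrite (le_trans (ler_rnormD _ _))// lerD //; first by rewrite rnormBC uc.
by rewrite rnormBC mul1r.
Qed.

End Rates.

(** * Normalizing linear combinations *)

Section LinearCombinations.
Context {K : comNzRingType} {V : lmodType K}.

(** Syntax of linear combinations of vectors, the variables being indices in a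
    list of vectors. *)
Inductive lexp :=
  | LVar of nat | LZero | LAdd of lexp & lexp | LOpp of lexp | LScale of K & lexp.

Fixpoint leval (env : seq V) (e : lexp) : V :=
  match e with
  | LVar i => nth 0 env i
  | LZero => 0
  | LAdd a b => leval env a + leval env b
  | LOpp a => - leval env a
  | LScale c a => c *: leval env a
  end.

Fixpoint lcoef (i : nat) (e : lexp) : K :=
  match e with
  | LVar j => if i == j then 1 else 0
  | LZero => 0
  | LAdd a b => lcoef i a + lcoef i b
  | LOpp a => - lcoef i a
  | LScale c a => c * lcoef i a
  end.

Lemma leval_sum env e : leval env e = \sum_(i < size env) lcoef i e *: nth 0 env i.
Proof.
elim: e => /= [j||a -> b ->|a ->|c a ->].
- have [jn|nj] := ltnP j (size env).
    rewrite (bigD1 (Ordinal jn)) //= eqxx scale1r big1 ?addr0 // => i ij.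
    by have := ij; rewrite -val_eqE /= => /negbTE ->; rewrite scale0r.
  rewrite nth_default // big1 // => i _; rewrite ltn_eqF ?scale0r //.
  exact: leq_trans (ltn_ord i) nj.
- by rewrite big1 // => i _; rewrite scale0r.
- by rewrite -big_split; apply: eq_bigr => i _; rewrite scalerDl.
- by rewrite -sumrN; apply: eq_bigr => i _; rewrite scaleNr.
- by rewrite scaler_sumr; apply: eq_bigr => i _; rewrite scalerA.
Qed.

Fixpoint lcoef_eq (n : nat) (a b : lexp) : Prop :=
  if n is m.+1 then lcoef m a = lcoef m b /\ lcoef_eq m a b else True.

Lemma lcoef_eqP env a b : lcoef_eq (size env) a b -> leval env a = leval env b.
Proof.
rewrite !leval_sum => ab; apply: eq_bigr => i _; congr (_ *: _).
case: i => i /=; elim: (size env) ab => //= n IHn [abn abl].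
by rewrite ltnS leq_eqVlt => /predU1P[->//|/IHn]; apply.
Qed.

End LinearCombinations.

Ltac lc_mem x l :=
  lazymatch l with
  | nil => constr:(x :: nil)
  | x :: _ => l
  | ?y :: ?l' => let r := lc_mem x l' in constr:(y :: r)
  end.
Ltac lc_atoms e l :=
  lazymatch e with
  | (?a + ?b)%R => let l' := lc_atoms a l in lc_atoms b l'
  | (- ?a)%R => lc_atoms a l
  | (?c *: ?a)%R => lc_atoms a l
  | 0%R => l
  | ?x => lc_mem x l
  end.
Ltac lc_index x l :=
  lazymatch l with
  | x :: _ => constr:(0%N)
  | _ :: ?l' => let i := lc_index x l' in constr:(i.+1)
  end.
Ltac lc_quote K e l :=
  lazymatch e with
  | (?a + ?b)%R =>
      let a' := lc_quote K a l in let b' := lc_quote K b l in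
      constr:(@LAdd K a' b')
  | (- ?a)%R => let a' := lc_quote K a l in constr:(@LOpp K a')
  | (?c *: ?a)%R => let a' := lc_quote K a l in constr:(@LScale K c a')
  | 0%R => constr:(@LZero K)
  | ?x => let i := lc_index x l in constr:(@LVar K i)
  end.
(** The tactic reduces an equality of linear combinations of vectors over [K] to the
    equalities of the coefficients of each atomic vector. *)
Ltac lincomb K :=
  lazymatch goal with
  | |- @eq ?V ?a ?b =>
    let l0 := lc_atoms a (@nil V) in let l := lc_atoms b l0 in
    let a' := lc_quote K a l in let b' := lc_quote K b l in
    apply: (@lcoef_eqP K _ l a' b'); do ?split; rewrite /=
  end.

(** * Left multiplication in a C*-algebra *)

Section CstarBasics.
Context {R : realType} {B : cstarAlgType R}.
Local Notation "a ** b" := (@cmul R B a b) (at level 40, left associativity).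
Local Notation "a ^#" := (@cstar R B a) (at level 2, format "a ^#").
Implicit Types (a b h w x y z : B) (c : R[i]).

Lemma cmulDl a b w : (a + b) ** w = a ** w + b ** w.
Proof. exact: linearDl. Qed.
Lemma cmulDr a b w : w ** (a + b) = w ** a + w ** b.
Proof. exact: linearDr. Qed.
Lemma cmulNl a w : (- a) ** w = - (a ** w).
Proof. exact: linearNl. Qed.
Lemma cmulNr a w : w ** (- a) = - (w ** a).
Proof. exact: linearNr. Qed.
Lemma cmulBl a b w : (a - b) ** w = a ** w - b ** w.
Proof. exact: linearBl. Qed.
Lemma cmulBr a b w : w ** (a - b) = w ** a - w ** b.
Proof. exact: linearBr. Qed.
Lemma cmulZl c a w : (c *: a) ** w = c *: (a ** w).
Proof. exact: linearZl_LR. Qed.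
Lemma cmulZr c a w : w ** (c *: a) = c *: (w ** a).
Proof. exact: linearZr_LR. Qed.
Lemma cmul0l w : 0 ** w = 0.
Proof. exact: linear0l. Qed.
Lemma cmul0r w : w ** 0 = 0.
Proof. exact: linear0r. Qed.

Definition cmulE := (cmulDl, cmulDr, cmulNl, cmulNr, cmulZl, cmulZr, cmul0l, cmul0r).

Lemma cstarZr (s : R) a : (s%:C *: a)^# = s%:C *: a^#.
Proof. by rewrite cstarZ; congr (_ *: _); rewrite conj_Creal // complex_real. Qed.

Lemma cstarZi a : (iu *: a)^# = - (iu *: a^#).
Proof. by rewrite cstarZ -scaleNr; congr (_ *: _); rewrite complexiE conjCi. Qed.

Lemma cstar0 : (0 : B)^# = 0.
Proof. by apply: (addrI (0 : B)^#); rewrite -cstarD !addr0. Qed.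

Lemma cstarN a : (- a)^# = - a^#.
Proof. by apply: (addrI a^#); rewrite -cstarD !subrr cstar0. Qed.

Lemma cstarB a b : (a - b)^# = a^# - b^#.
Proof. by rewrite cstarD cstarN. Qed.

Lemma rnormM a b : rnorm (a ** b) <= rnorm a * rnorm b.
Proof. by have := cnormM a b; rewrite !rnormE -rmorphM lecR. Qed.

Lemma rnorm_star_mul a : rnorm (a^# ** a) = rnorm a ^+ 2.
Proof.
by have := cnorm_star_mul a; rewrite !rnormE -rmorphXn => /complexI.
Qed.

Lemma rnorm_star a : rnorm a^# = rnorm a.
Proof.
suff le b : rnorm b <= rnorm b^#.
  by apply/le_anti; rewrite le andbT -{2}(cstarK a) le.
have [->|b0] := eqVneq (rnorm b) 0; first exact: rnorm_ge0.
have b_gt0 : 0 < rnorm b by rewrite lt_neqAle eq_sym b0 rnorm_ge0.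
by rewrite -(ler_pM2r b_gt0) -expr2 -rnorm_star_mul rnormM.
Qed.

Definition selfadj a := a^# = a.

Lemma selfadjD a b : selfadj a -> selfadj b -> selfadj (a + b).
Proof. by rewrite /selfadj cstarD => -> ->. Qed.

Lemma selfadjN a : selfadj a -> selfadj (- a).
Proof. by rewrite /selfadj cstarN => ->. Qed.

Lemma selfadjB a b : selfadj a -> selfadj b -> selfadj (a - b).
Proof. by move=> aA bA; apply: selfadjD => //; apply: selfadjN. Qed.

Lemma selfadjZ (s : R) a : selfadj a -> selfadj (s%:C *: a).
Proof. by rewrite /selfadj cstarZr => ->. Qed.

Lemma selfadjMM a : selfadj a -> selfadj (a ** a).
Proof. by rewrite /selfadj cstarM => ->. Qed.

Lemma rnorm_sq a : selfadj a -> rnorm (a ** a) = rnorm a ^+ 2.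
Proof. by move=> aA; rewrite -{1}aA rnorm_star_mul. Qed.

(** Take w = a, the square of a self-adjoint element having the square of its
    norm. *)
Lemma rnorm_leftmul a (d : R) : selfadj a -> 0 <= d ->
  (forall w, rnorm (a ** w) <= d * rnorm w) -> rnorm a <= d.
Proof.
move=> aA d0 aw; have [->//|a0] := eqVneq (rnorm a) 0.
have a_gt0 : 0 < rnorm a by rewrite lt_neqAle eq_sym a0 rnorm_ge0.
by rewrite -(ler_pM2r a_gt0) -expr2 -rnorm_sq.
Qed.

End CstarBasics.

(** * Square roots *)

Section SquareRoots.
Context {R : realType} {B : cstarAlgType R}.
Local Notation "a ** b" := (@cmul R B a b) (at level 40, left associativity).
Local Notation "a ^#" := (@cstar R B a) (at level 2, format "a ^#").
Implicit Types (a b c g h w x y z t p q : B).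

(** These are the positive elements with spectrum in [0, 2]. Expressed by the
    operator of multiplication by 1 - x, the condition requires neither a unit
    nor the spectrum, and it is preserved by convex combinations and limits. *)
Definition pos_le2 x := selfadj x /\ forall w, rnorm (w - x ** w) <= rnorm w.

Lemma pos_le2_norm x : pos_le2 x -> rnorm x <= 2.
Proof.
move=> [xA xc]; apply: rnorm_leftmul => // w.
have -> : x ** w = w - (w - x ** w) by rewrite opprB addrC subrK.
by rewrite (le_trans (ler_rnormB _ _)) // mulrDl mul1r lerD.
Qed.

Lemma pos_le2_0 : pos_le2 0.
Proof. by split; [exact: cstar0 | move=> w; rewrite cmul0l subr0]. Qed.

Lemma pos_le2_mid x y : pos_le2 x -> pos_le2 y -> pos_le2 ((2^-1 : R)%:C *: (x + y)).
Proof.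
move=> [xA xc] [yA yc]; split; first by apply: selfadjZ; apply: selfadjD.
move=> w.
have -> : w - (2^-1 : R)%:C *: (x + y) ** w =
    (2^-1 : R)%:C *: ((w - x ** w) + (w - y ** w)).
  by rewrite fmorphV rmorph_nat !cmulE; lincomb R[i]; field.
rewrite rnormZr ger0_norm ?invr_ge0 // ler_pdivrMl //.
by rewrite (le_trans (ler_rnormD _ _)) // mulr2n mulrDl mul1r lerD.
Qed.

Lemma selfadj_rate (u : nat -> B) l (k : R) :
  (forall n, selfadj (u n)) -> (forall n, rnorm (u n - l) <= k / n.+1%:R) ->
  selfadj l.
Proof.
move=> uA ul; apply: (@eq_rate _ _ _ _ (k + k)) => n.
have -> : l^# - l = (l - u n)^# + (u n - l) by rewrite cstarB uA addrA subrK.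
rewrite (le_trans (ler_rnormD _ _)) // rnorm_star mulrDl lerD //.
by rewrite rnormBC.
Qed.

Lemma pos_le2_rate (u : nat -> B) l (k : R) :
  (forall n, pos_le2 (u n)) -> (forall n, rnorm (u n - l) <= k / n.+1%:R) ->
  pos_le2 l.
Proof.
move=> uK ul; split; first by apply: (selfadj_rate _ ul) => n; have [] := uK n.
move=> w; apply: (@ler_rate _ _ _ (k * rnorm w)) => n.
have -> : w - l ** w = (w - u n ** w) + (u n - l) ** w.
  by rewrite cmulBl addrA subrK.
rewrite (le_trans (ler_rnormD _ _)) // lerD //; first by have [_] := uK n.
by rewrite (le_trans (rnormM _ _)) // mulrAC ler_wpM2r ?rnorm_ge0.
Qed.

(** The vectors (1 + i h) w and (1 - i h) w have the same norm, both having
    w* (1 + h h) w as their square, and w is half their sum. *)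
Lemma rnorm_add_sq h w : selfadj h -> rnorm w <= rnorm (w + h ** (h ** w)).
Proof.
move=> hA; set v := w + _.
have sqE s : s * s = -1 -> s^* = - s ->
    (w + s *: (h ** w))^# ** (w + s *: (h ** w)) = w^# ** v.
  move=> s2 sC.
  rewrite cstarD cstarZ cstarM hA sC /v !cmulE -!cmulA !scalerA mulNr s2 opprK.
  by rewrite scale1r; lincomb R[i]; ring.
pose a := w + iu *: (h ** w); pose b := w + (- iu) *: (h ** w).
have i2 : iu * iu = -1 :> R[i] by rewrite -expr2 sqr_i.
have iC : (iu : R[i])^* = - iu by rewrite complexiE conjCi.
have iNC : (- iu : R[i])^* = - - iu by rewrite rmorphN /= iC.
have aE : rnorm a ^+ 2 <= rnorm w * rnorm v.
  by rewrite -rnorm_star_mul (sqE iu) // (le_trans (rnormM _ _)) // rnorm_star.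
have bE : rnorm b ^+ 2 <= rnorm w * rnorm v.
  rewrite -rnorm_star_mul (sqE (- iu)) ?mulrNN //.
  by rewrite (le_trans (rnormM _ _)) // rnorm_star.
have w2 : rnorm w + rnorm w <= rnorm a + rnorm b.
  have wab : w + w = a + b by rewrite /a /b; lincomb R[i]; ring.
  have <- : rnorm (w + w) = rnorm w + rnorm w.
    have -> : w + w = (2 : R)%:C *: w by rewrite rmorph_nat; lincomb R[i]; ring.
    by rewrite rnormZr ger0_norm // mulr2n mulrDl mul1r.
  by rewrite wab ler_rnormD.
have [w0|w0] := eqVneq (rnorm w) 0; first by rewrite w0 rnorm_ge0.
have w_gt0 : 0 < rnorm w by rewrite lt_neqAle eq_sym w0 rnorm_ge0.
rewrite -(ler_pM2l w_gt0).
have w4 : (rnorm w + rnorm w) ^+ 2 <= (rnorm a + rnorm b) ^+ 2.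
  by rewrite lerXn2r ?nnegrE ?addr_ge0 ?rnorm_ge0.
have := sqr_ge0 (rnorm a - rnorm b); nra.
Qed.

(** By rnorm_add_sq for x = h h, the factor 1 + x does not decrease norms,
    and (1 + x)(1 - x) = 1 - x x; so the norm of (1 - x) w is at most that
    of (1 - x^(2^n)) w, which tends to the norm of w. *)
Lemma pos_le2_sq h : selfadj h -> rnorm h < 1 -> pos_le2 (h ** h).
Proof.
move=> hA h1; split; first exact: selfadjMM.
move=> w.
pose x n := iter n (fun y => y ** y) h.
have xA n : selfadj (x n) by elim: n => //= n; exact: selfadjMM.
have xN n : rnorm (x n) <= rnorm h ^+ n.+1.
  elim: n => [|n IHn]; first by rewrite expr1.
  rewrite /= rnorm_sq //.
  rewrite (le_trans (lerXn2r _ _ _ IHn)) ?nnegrE ?exprn_ge0 ?rnorm_ge0 //.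
  rewrite -exprM ler_wiXn2l ?rnorm_ge0 ?ltW //.
  by rewrite mulnC mul2n -addnn addSn ltnS leq_addl.
have step n : rnorm (w - x n.+1 ** w) <= rnorm (w - x n.+2 ** w).
  apply: le_trans (rnorm_add_sq _ (xA n)) _; rewrite cmulA -/(x n.+1).
  have -> : x n.+2 = x n.+1 ** x n.+1 by [].
  by rewrite cmulBr cmulA addrA subrK.
have le n : rnorm (w - h ** h ** w) <= rnorm (w - x n.+1 ** w).
  by elim: n => // n IHn; apply: le_trans IHn _.
have [h0|h0] := eqVneq (rnorm h) 0.
  by rewrite (rnorm_eq0 h0) !cmul0l subr0.
have h_gt0 : 0 < rnorm h by rewrite lt_neqAle eq_sym h0 rnorm_ge0.
pose s := (rnorm h)^-1 - 1.
have s_gt0 : 0 < s by rewrite subr_gt0 invf_gt1.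
have sE : rnorm h = (1 + s)^-1 by rewrite /s addrC subrK invrK.
apply: (@ler_rate _ _ _ (s^-1 * rnorm w)) => n.
rewrite (le_trans (le n)) // (le_trans (ler_rnormB _ _)) // lerD //.
rewrite (le_trans (rnormM _ _)) // mulrAC ler_wpM2r ?rnorm_ge0 //.
rewrite (le_trans (xN n.+1)) // sE exprVn -invfM.
have s1 : 0 < 1 + s by rewrite addr_gt0.
have s_pow : 0 < (1 + s) ^+ n.+2 by rewrite exprn_gt0.
rewrite lef_pV2 ?posrE //; last by rewrite mulr_gt0 ?ltr0n.
have := bernoulli n.+2 (ltW s_gt0); rewrite -natr1; have : 0 <= n.+1%:R :> R by []; nra.
Qed.

End SquareRoots.

Section SquareRootExistence.
Context {R : realType} {B : cstarAlgType R}.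
Local Notation "a ** b" := (@cmul R B a b) (at level 40, left associativity).
Local Notation "a ^#" := (@cstar R B a) (at level 2, format "a ^#").
Implicit Types (a b c g h w x y z t p q : B).

(** The numbers 1 - r_n are the iterates of y -> (1 + y y) / 2 from 0. *)
Fixpoint sqrt_rate n : R :=
  if n is m.+1 then sqrt_rate m - sqrt_rate m ^+ 2 / 2 else 1.

Lemma sqrt_rateS n : sqrt_rate n.+1 = sqrt_rate n - sqrt_rate n ^+ 2 / 2.
Proof. by []. Qed.

Lemma sqrt_rate_bound n : 0 < sqrt_rate n <= 2 / n.+2%:R.
Proof.
elim: n => [|n /andP[r0 rn]] /=; first by rewrite ltr01 divff ?pnatr_eq0 //= lexx.
set r := sqrt_rate n in r0 rn *.
have k0 : 0 <= n%:R :> R by [].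
set k := n%:R in k0.
have e2 : n.+2%:R = k + 2 by rewrite -(natrD _ n 2) addn2.
have e3 : n.+3%:R = k + 3 by rewrite -(natrD _ n 3) addn3.
have r1 : r <= 1.
  by rewrite (le_trans rn) // e2 ler_pdivrMr; lra.
apply/andP; split; first by nra.
rewrite e3 ler_pdivlMr; last by lra.
rewrite e2 in rn.
have k2 : 0 < k + 2 by lra.
have rn2 : r * (k + 2) <= 2 by move: rn; rewrite ler_pdivlMr.
nra.
Qed.

Lemma sqrt_rate_ge0 n : 0 <= sqrt_rate n.
Proof. by have /andP[/ltW] := sqrt_rate_bound n. Qed.

Lemma sqrt_rate_le n : sqrt_rate n <= 2 / n.+1%:R.
Proof.
have /andP[_ /le_trans->] // := sqrt_rate_bound n.
by rewrite ler_pM2l // lef_pV2 ?posrE ?ltr0n // ler_nat.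
Qed.

Lemma sqrt_rate_le1 n : sqrt_rate n <= 1.
Proof.
have /andP[_ /le_trans->] // := sqrt_rate_bound n.
by rewrite ler_pdivrMr ?ltr0n // mul1r ler_nat.
Qed.

Section Iteration.
Context (t : B) (tK : pos_le2 t).

Fixpoint sqrt_seq n : B :=
  if n is m.+1 then
    sqrt_seq m + (2^-1 : R)%:C *:
      (t - (2 * sqrt_rate m)%:C *: sqrt_seq m - sqrt_seq m ** sqrt_seq m)
  else 0.

(** The iterates of Y -> ((1 - t) + Y Y) / 2 from 0, as sqrt_opS shows. They
    involve the scalar 1 - r_n, so it is the recurrence for their part in the
    algebra that defines sqrt_seq. *)
Definition sqrt_op n w := (1 - sqrt_rate n)%:C *: w - sqrt_seq n ** w.

Lemma sqrt_opB n w z : sqrt_op n (w - z) = sqrt_op n w - sqrt_op n z.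
Proof. by rewrite /sqrt_op !cmulE; lincomb R[i]; ring. Qed.

Lemma sqrt_opS n w :
  sqrt_op n.+1 w = (2^-1 : R)%:C *: ((w - t ** w) + sqrt_op n (sqrt_op n w)).
Proof.
rewrite /sqrt_op /= !cmulE -?cmulA; set r := sqrt_rate n.
by lincomb R[i]; field.
Qed.

Lemma sqrt_op0 w : sqrt_op 0 w = 0.
Proof. by rewrite /sqrt_op /= subrr cmul0l subr0 scale0r. Qed.

Lemma sqrt_op_norm n w : rnorm (sqrt_op n w) <= (1 - sqrt_rate n) * rnorm w.
Proof.
elim: n w => [|n IHn] w; first by rewrite sqrt_op0 rnorm0 subrr mul0r.
rewrite sqrt_opS rnormZr ger0_norm ?invr_ge0 // ler_pdivrMl //.
rewrite (le_trans (ler_rnormD _ _)) //=.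
have [_ tc] := tK.
have := tc w; have := IHn w; have := IHn (sqrt_op n w).
have := sqrt_rate_le1 n; have := sqrt_rate_ge0 n; have := rnorm_ge0 w.
have := rnorm_ge0 (sqrt_op n w).
set r := sqrt_rate n => a0 b0 r0 r1 e1 e2 e3.
have : (1 - r) * rnorm (sqrt_op n w) <= (1 - r) * ((1 - r) * rnorm w).
  by rewrite ler_wpM2l // subr_ge0.
nra.
Qed.

(** The increment of Y Y is Y' (Y' - Y) + (Y' - Y) Y, which is estimated by the
    corresponding expression for the numbers 1 - r_n. *)
Lemma sqrt_op_step n w :
  rnorm (sqrt_op n.+1 w - sqrt_op n w) <= (sqrt_rate n - sqrt_rate n.+1) * rnorm w.
Proof.
elim: n w => [|n IHn] w.
  rewrite sqrt_op0 subr0 sqrt_opS !sqrt_op0 addr0 rnormZr ger0_norm ?invr_ge0 //.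
  rewrite /= expr1n opprD addNKr opprK div1r mulrC -[leRHS]mulrC ler_wpM2r ?invr_ge0 //.
  by have [_] := tK.
set u := sqrt_op n w; set v := sqrt_op n.+1 w.
have -> : sqrt_op n.+2 w - v = (2^-1 : R)%:C *:
    (sqrt_op n.+1 (v - u) + (sqrt_op n.+1 u - sqrt_op n u)).
  rewrite (sqrt_opS n.+1 w) (sqrt_opB n.+1 v u) -/v.
  rewrite [X in _ - X = _](sqrt_opS n w) -/u.
  by lincomb R[i]; field.
rewrite rnormZr ger0_norm ?invr_ge0 // ler_pdivrMl //.
rewrite (le_trans (ler_rnormD _ _)) //.
have e1 := IHn u; have e2 := IHn w; have e3 := sqrt_op_norm n.+1 (v - u).
have e4 := sqrt_op_norm n w; rewrite -/u -/v in e1 e2 e3 e4.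
have s0 : 0 <= sqrt_rate n - sqrt_rate n.+1.
  by rewrite /= opprD addNKr opprK divr_ge0 // sqr_ge0.
have r1 : 0 <= 1 - sqrt_rate n.+1 by rewrite subr_ge0 sqrt_rate_le1.
have f1 : rnorm (sqrt_op n.+1 u - sqrt_op n u) <=
    (sqrt_rate n - sqrt_rate n.+1) * ((1 - sqrt_rate n) * rnorm w).
  by rewrite (le_trans e1) // ler_wpM2l.
have f2 : rnorm (sqrt_op n.+1 (v - u)) <=
    (1 - sqrt_rate n.+1) * ((sqrt_rate n - sqrt_rate n.+1) * rnorm w).
  by rewrite (le_trans e3) // ler_wpM2l.
rewrite (le_trans (lerD f2 f1)) // (sqrt_rateS n.+1) (sqrt_rateS n).
set r := sqrt_rate n; rewrite le_eqVlt; apply/orP; left; apply/eqP.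
by field.
Qed.

Lemma sqrt_op_dist n m w : (n <= m)%N ->
  rnorm (sqrt_op m w - sqrt_op n w) <= (sqrt_rate n - sqrt_rate m) * rnorm w.
Proof.
elim: m => [|m IHm]; first by rewrite leqn0 => /eqP ->; rewrite !subrr rnorm0 mul0r.
rewrite leq_eqVlt => /predU1P[->|]; first by rewrite !subrr rnorm0 mul0r.
rewrite ltnS => nm.
have -> : sqrt_op m.+1 w - sqrt_op n w =
    (sqrt_op m.+1 w - sqrt_op m w) + (sqrt_op m w - sqrt_op n w).
  by rewrite addrA subrK.
rewrite (le_trans (ler_rnormD _ _)) // (le_trans (lerD (sqrt_op_step _ _) (IHm nm))) //.
by rewrite -mulrDl addrC subrKA.
Qed.

Lemma sqrt_seq_selfadj n : selfadj (sqrt_seq n).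
Proof.
have [tA _] := tK; elim: n => [|n IHn] /=; first exact: cstar0.
by do ![exact: tA | exact: IHn | apply: selfadjD | apply: selfadjN
  | apply: selfadjZ | apply: selfadjMM].
Qed.

Lemma sqrt_seq_comm g n : g ** t = t ** g -> g ** sqrt_seq n = sqrt_seq n ** g.
Proof.
move=> gt; elim: n => [|n IHn] /=; first by rewrite cmul0l cmul0r.
rewrite !cmulE gt IHn cmulA IHn -cmulA IHn cmulA.
by [].
Qed.

Lemma sqrt_seq_dist n m : (n <= m)%N ->
  rnorm (sqrt_seq m - sqrt_seq n) <= 4 / n.+1%:R.
Proof.
move=> nm; rewrite (@le_trans _ _ (2 * sqrt_rate n)) //; last first.
  by have := sqrt_rate_le n; set x := n.+1%:R^-1; lra.
apply: rnorm_leftmul => [||w]; first by apply: selfadjB; exact: sqrt_seq_selfadj.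
  by rewrite mulr_ge0 // sqrt_rate_ge0.
have -> : (sqrt_seq m - sqrt_seq n) ** w =
    (sqrt_rate n - sqrt_rate m)%:C *: w - (sqrt_op m w - sqrt_op n w).
  by rewrite /sqrt_op !cmulE; lincomb R[i]; ring.
rewrite (le_trans (ler_rnormB _ _)) // rnormZr.
have d := sqrt_op_dist w nm; have r0 := sqrt_rate_ge0 m.
have w0 := rnorm_ge0 w.
have d0 : 0 <= sqrt_rate n - sqrt_rate m.
  elim: m nm {d r0} => [|m IHm]; first by rewrite leqn0 => /eqP->; rewrite subrr.
  rewrite leq_eqVlt => /predU1P[->|]; first by rewrite subrr.
  rewrite ltnS => /IHm /= e; rewrite opprB addrCA addr_ge0 //.
  by rewrite divr_ge0 // sqr_ge0.
by rewrite ger0_norm //; have := mulr_ge0 r0 w0; lra.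
Qed.

End Iteration.

(** With Y = 1 - c, the equation c c = t becomes Y = ((1 - t) + Y Y) / 2, which
    is solved by iteration from 0. As 1 - t is a contraction, the increments of
    the iterates Y_n are dominated by those of the same iteration for the
    number 1, whose terms 1 - r_n increase to 1. Without a unit, Y_n is the
    operator (1 - r_n) - d_n with d_n in the algebra, and d_n tends to c. *)
Theorem pos_le2_sqrt t : pos_le2 t -> exists c, [/\ pos_le2 c, c ** c = t &
  forall g, g ** t = t ** g -> g ** c = c ** g].
Proof.
move=> tK; have [c cl] := complete_rate (fun n m => @sqrt_seq_dist t tK n m).
exists c; pose d := sqrt_seq t.
have dN n : rnorm (d n) <= 4.
  by have := sqrt_seq_dist tK (leq0n n); rewrite subr0 divr1.
have cN : rnorm c <= 4.
  by have := cl 0%N; rewrite /= sub0r rnormN divr1.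
have dA := sqrt_seq_selfadj tK.
split.
- split; first exact: selfadj_rate dA cl.
  move=> w; apply: (@ler_rate _ _ _ (4 * rnorm w)) => n.
  have -> : w - c ** w = ((sqrt_rate n)%:C *: w + sqrt_op t n w) + (d n - c) ** w.
    by rewrite /sqrt_op -/(d n) !cmulE; lincomb R[i]; ring.
  rewrite (le_trans (ler_rnormD _ _)) // lerD //; last first.
    by rewrite (le_trans (rnormM _ _)) // mulrAC ler_wpM2r ?rnorm_ge0.
  rewrite (le_trans (ler_rnormD _ _)) // rnormZr ger0_norm ?sqrt_rate_ge0 //.
  by have := sqrt_op_norm tK n w; lra.
- apply/esym/(@eq_rate _ _ _ _ 56) => n.
  (* The recurrence expresses t - d_n d_n by d_(n+1) - d_n and r_n d_n. *)
  have -> : t - c ** c = ((2 : R)%:C *: (d n.+1 - d n) + (2 * sqrt_rate n)%:C *: d n)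
      + (d n ** (d n - c) + (d n - c) ** c).
    by rewrite /d /= -/(d n) !cmulE; lincomb R[i]; field.
  have e := cl n; have e' := sqrt_seq_dist tK (leqnSn n).
  have er := sqrt_rate_le n; have r0 := sqrt_rate_ge0 n.
  rewrite -/(d n) -/(d n.+1) in e e'.
  have d0 := rnorm_ge0 (d n); have c0 := rnorm_ge0 c.
  have dc0 := rnorm_ge0 (d n - c).
  move: e e' er; set x := n.+1%:R^-1 => e e' er.
  have b1 : rnorm ((2 : R)%:C *: (d n.+1 - d n)) <= 8 * x.
    by rewrite rnormZr ger0_norm //; lra.
  have b2 : rnorm ((2 * sqrt_rate n)%:C *: d n) <= 16 * x.
    by rewrite rnormZr ger0_norm ?mulr_ge0 //; have := dN n; nra.
  have b3 : rnorm (d n ** (d n - c)) <= 16 * x.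
    by have := rnormM (d n) (d n - c); have := dN n; nra.
  have b4 : rnorm ((d n - c) ** c) <= 16 * x.
    by have := rnormM (d n - c) c; nra.
  apply: le_trans (ler_rnormD _ _) _.
  have := ler_rnormD ((2 : R)%:C *: (d n.+1 - d n)) ((2 * sqrt_rate n)%:C *: d n).
  have := ler_rnormD (d n ** (d n - c)) ((d n - c) ** c).
  lra.
- move=> g gt; apply: (@eq_rate _ _ _ _ (8 * rnorm g)) => n.
  have -> : g ** c - c ** g = (d n - c) ** g - g ** (d n - c).
    have gd : g ** d n = d n ** g := sqrt_seq_comm n gt.
    by rewrite !cmulE gd; lincomb R[i]; ring.
  have e := cl n; rewrite -/(d n) in e.
  rewrite (le_trans (ler_rnormB _ _)) //.
  have := rnormM (d n - c) g; have := rnormM g (d n - c).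
  have := rnorm_ge0 g; move: e; set x := n.+1%:R^-1; nra.
Qed.

End SquareRootExistence.

(** * Differences of positive elements *)

Section Decomposition.
Context {R : realType} {B : cstarAlgType R}.
Local Notation "a ** b" := (@cmul R B a b) (at level 40, left associativity).
Local Notation "a ^#" := (@cstar R B a) (at level 2, format "a ^#").
Implicit Types (a b c g h w x y z t p q : B).

Lemma pow2_growth (y k : R) : 0 <= y ->
  (forall m, y ^+ (2 ^ m) <= 1 + (2 ^ m)%:R * k) -> y <= 1.
Proof.
move=> y0 yk; rewrite leNgt; apply/negP => y1.
pose s := y - 1; have s0 : 0 < s by rewrite subr_gt0.
have bern n : 1 + n%:R * s <= y ^+ n.
  by have := bernoulli n (ltW s0); rewrite [1 + s]addrC subrK.
have k0 : 0 <= k by have := yk 0%N; rewrite expn0 expr1 mul1r; lra.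
pose m := (Num.trunc ((1 + 2 * k) / s ^+ 2)).+1.
have mP : (1 + 2 * k) / s ^+ 2 < (2 ^ m)%:R.
  rewrite (lt_le_trans (truncnS_gt _)) // ler_nat.
  by rewrite ltnW // ltn_expl.
have := yk m.+1; rewrite expnSr exprM natrM; apply/negP; rewrite -ltNge.
have := bern (2 ^ m)%N; move: mP; rewrite ltr_pdivrMr ?exprn_gt0 //.
have : 1 <= (2 ^ m)%:R :> R by rewrite ler1n expn_gt0.
set N := (2 ^ m)%:R; set Y := y ^+ _ => N1 sN NY.
have Ns0 : 0 <= N * s by rewrite mulr_ge0 // ltW.
have Y0 : 0 <= Y by lra.
have : (N * s) ^+ 2 <= Y ^+ 2 by rewrite lerXn2r ?nnegrE //; lra.
have : N * (1 + 2 * k) < N * (N * s ^+ 2) by rewrite ltr_pM2l //; lra.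
by rewrite exprMn expr2 -mulrA; lra.
Qed.

(** Write A for multiplication by 1 - p. As A p = p (1 - c), the operators
    A^k p = p (1 - c)^k are bounded by the norm of p, so that the norm of
    A^n = 1 - p - A p - ... - A^(n-1) p grows at most linearly. But A is
    self-adjoint, which gives |A^k z|^2 <= |z| |A^(2k) z|: if A increased the
    norm of z, the norms |A^(2^m) z| would grow geometrically in 2^m. *)
Lemma pos_le2_of_sq p c : selfadj p -> pos_le2 c -> p ** p = p ** c -> pos_le2 p.
Proof.
move=> pA [_ cK] pc; split=> // z.
pose A w := w - p ** w; pose C w := w - c ** w.
have AB w v : A (w - v) = A w - A v by rewrite /A !cmulE; lincomb R[i]; ring.
have AnB n w v : iter n A (w - v) = iter n A w - iter n A v.
  by elim: n => //= n ->.
have Anp n w : iter n A (p ** w) = p ** iter n C w.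
  elim: n w => // n IHn w; rewrite !iterSr -IHn; congr (iter n A _).
  by rewrite /A /C cmulA pc cmulBr cmulA.
have Cn n w : rnorm (iter n C w) <= rnorm w.
  by elim: n => //= n IHn; apply: le_trans (cK _) IHn.
have An n w : rnorm (iter n A w) <= (1 + n%:R * rnorm p) * rnorm w.
  elim: n => [|n IHn]; first by rewrite /= mul0r addr0 mul1r.
  rewrite iterSr {2}/A AnB (le_trans (ler_rnormB _ _)) // Anp.
  have := rnormM p (iter n C w); have := ler_wpM2l (rnorm_ge0 p) (Cn n w).
  rewrite -natr1; lra.
have Astar n w v : (iter n A w)^# ** v = w^# ** iter n A v.
  elim: n w v => // n IHn w v; rewrite iterSr iterS IHn /A cstarB cstarM pA.
  by rewrite cmulBl cmulBr cmulA.
have Asq n w : rnorm (iter n A w) ^+ 2 <= rnorm w * rnorm (iter (n + n) A w).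
  rewrite -rnorm_star_mul Astar -iterD (le_trans (rnormM _ _)) //.
  by rewrite rnorm_star.
have [z0|z0] := eqVneq (rnorm z) 0.
  by rewrite (rnorm_eq0 z0) cmul0r subr0.
have z_gt0 : 0 < rnorm z by rewrite lt_neqAle eq_sym z0 rnorm_ge0.
rewrite -[leRHS]mul1r -ler_pdivrMr //.
apply: (@pow2_growth _ (rnorm p)) => [|m]; first by rewrite divr_ge0 ?rnorm_ge0.
apply: (@le_trans _ _ (rnorm (iter (2 ^ m) A z) / rnorm z)); last first.
  by rewrite ler_pdivrMr.
elim: m => [|m IHm]; first by rewrite expn0 expr1.
rewrite expnS mul2n -addnn exprD -expr2.
apply: (@le_trans _ _ ((rnorm (iter (2 ^ m) A z) / rnorm z) ^+ 2)).
  by rewrite lerXn2r ?nnegrE ?exprn_ge0 ?divr_ge0 ?rnorm_ge0.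
rewrite expr_div_n ler_pdivrMr ?exprn_gt0 //.
rewrite (le_trans (Asq _ _)) // expr2 mulrA divfK // mulrC.
by rewrite lexx.
Qed.

(** The two parts are (c + h) / 2 and (c - h) / 2 for c the square root of
    h h; each of them satisfies p p = p c. *)
Lemma selfadj_decomp h : selfadj h -> rnorm h < 1 ->
  exists p q, [/\ pos_le2 p, pos_le2 q & h = p - q].
Proof.
move=> hA h1; have [c [cK cc ch]] := pos_le2_sqrt (pos_le2_sq hA h1).
have [cA _] := cK; have {}ch : h ** c = c ** h by apply: ch; rewrite cmulA.
have half g : selfadj g -> g ** g = c ** c -> g ** c = c ** g ->
    pos_le2 ((2^-1 : R)%:C *: (c + g)).
  move=> gA gg gc; apply: (@pos_le2_of_sq _ c) => //.
    by apply: selfadjZ; apply: selfadjD.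
  by rewrite !cmulE gg gc; lincomb R[i]; field.
exists ((2^-1 : R)%:C *: (c + h)), ((2^-1 : R)%:C *: (c - h)); split.
- exact: half.
- by apply: half; [exact: selfadjN | rewrite !cmulE opprK -cc | rewrite !cmulE ch].
- by lincomb R[i]; field.
Qed.

Lemma pos_le2_cpositive x : pos_le2 x -> cpositive x.
Proof.
by move=> /pos_le2_sqrt[c [[cA _] cc _]]; exists c; rewrite cA cc.
Qed.

(** Real and imaginary parts: b = cre b + i cim b. *)
Definition cre b : B := (2^-1 : R)%:C *: (b + b^#).
Definition cim b : B := (2^-1 : R)%:C *: (iu *: (b^# - b)).

Lemma cre_selfadj b : selfadj (cre b).
Proof. by apply: selfadjZ; rewrite /selfadj cstarD cstarK addrC. Qed.

Lemma cim_selfadj b : selfadj (cim b).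
Proof.
by apply: selfadjZ; rewrite /selfadj cstarZi cstarB cstarK -scalerN opprB.
Qed.

Lemma cre_norm b : rnorm (cre b) <= rnorm b.
Proof.
rewrite rnormZr ger0_norm ?invr_ge0 //.
by have := ler_rnormD b b^#; rewrite rnorm_star; lra.
Qed.

Lemma cim_norm b : rnorm (cim b) <= rnorm b.
Proof.
rewrite rnormZr rnormZi ger0_norm ?invr_ge0 //.
by have := ler_rnormB b^# b; rewrite rnorm_star; lra.
Qed.

Lemma cre_cim b : b = cre b + iu *: cim b.
Proof.
have i2 : iu * iu = -1 :> R[i] by rewrite -expr2 sqr_i.
by rewrite /cre /cim; lincomb R[i]; field: i2.
Qed.

End Decomposition.

(** * Positive functionals *)

Section PositiveFunctionals.
Context {R : realType} {B : cstarAlgType R}.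
Local Notation "a ** b" := (@cmul R B a b) (at level 40, left associativity).
Local Notation "a ^#" := (@cstar R B a) (at level 2, format "a ^#").
Implicit Types (a b c g h w x y z t p q : B) (f : posFunctional B).

Lemma posfun_pos_le2 f x : pos_le2 x -> 0 <= f x.
Proof. by move=> xK; apply/posfun_ge0/pos_le2_cpositive. Qed.

(** The element is the sum of the p_n / 2^(n+1). Its tails, being limits of
    convex combinations of the p_n and 0, are positive again. *)
Lemma pos_le2_dominated (p : nat -> B) : (forall n, pos_le2 (p n)) ->
  exists x, forall f n, f (p n) <= 2 ^+ n.+1 * f x.
Proof.
move=> pK.
(* S m n is the sum of the p_(n+i) / 2^(i+1) for i < m. *)
pose fix S (m n : nat) {struct m} : B :=
  if m is k.+1 then (2^-1 : R)%:C *: (p n + S k n.+1) else 0.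
have SK m n : pos_le2 (S m n).
  elim: m n => [|m IHm] n; first exact: pos_le2_0.
  exact: pos_le2_mid.
have Sd m k n : (m <= k)%N -> rnorm (S k n - S m n) <= 2 / m.+1%:R.
  suff: (m <= k)%N -> rnorm (S k n - S m n) * 2 ^+ m <= 2.
    move=> H /H mk; rewrite ler_pdivlMr ?ltr0n // (le_trans _ mk) //.
    by rewrite ler_wpM2l ?rnorm_ge0 // -natrX ler_nat ltn_expl.
  elim: m k n => [|m IHm] k n.
    by rewrite subr0 expr0 mulr1 => _; exact: pos_le2_norm.
  case: k => // k mk /=.
  have -> : (2^-1 : R)%:C *: (p n + S k n.+1) - (2^-1 : R)%:C *: (p n + S m n.+1)
      = (2^-1 : R)%:C *: (S k n.+1 - S m n.+1) by lincomb R[i]; ring.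
  rewrite rnormZr ger0_norm ?invr_ge0 // exprS.
  by have := IHm _ n.+1 mk; set u := rnorm _; set v := _ ^+ m; lra.
have T_ex n : exists x, forall m, rnorm (S m n - x) <= 2 / m.+1%:R.
  by apply: complete_rate => m k; exact: Sd.
have [T TP] := choice T_ex.
have TK n : pos_le2 (T n) by apply: pos_le2_rate (TP n) => m; exact: SK.
have TE n : T n = (2^-1 : R)%:C *: (p n + T n.+1).
  apply: (@eq_rate _ _ _ _ 4) => m.
  have -> : T n - (2^-1 : R)%:C *: (p n + T n.+1) =
      (2^-1 : R)%:C *: (S m n.+1 - T n.+1) - (S m.+1 n - T n).
    by rewrite [S m.+1 n]/=; lincomb R[i]; ring.
  rewrite (le_trans (ler_rnormB _ _)) // rnormZr ger0_norm ?invr_ge0 //.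
  have := TP n.+1 m; have := TP n m.+1.
  have : m.+2%:R^-1 <= m.+1%:R^-1 :> R.
    by rewrite lef_pV2 ?posrE ?ltr0n // ler_nat.
  have : 0 <= m.+1%:R^-1 :> R by [].
  set u := m.+1%:R^-1; set v := m.+2%:R^-1; lra.
exists (T 0%N) => f n.
have fT k : f (p k) = 2 * f (T k) - f (T k.+1).
  rewrite (TE k) linearZ /= linearD /= fmorphV rmorph_nat.
  by rewrite mulVKf ?pnatr_eq0 // addrK.
have fT0 k : 0 <= f (T k) by exact: posfun_pos_le2.
have fTn k : f (T k) <= 2 ^+ k * f (T 0%N).
  elim: k => [|k IHk]; first by rewrite expr0 mul1r.
  rewrite exprS -mulrA (le_trans _ (_ : 2 * f (T k) <= _)) //.
    by have := posfun_pos_le2 f (pK k); rewrite fT subr_ge0.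
  by rewrite ler_wpM2l.
rewrite fT exprS -mulrA (@le_trans _ _ (2 * f (T n))) //.
  by rewrite lerBlDr lerDl.
by rewrite ler_wpM2l.
Qed.

(** Every element is a combination of four elements of pos_le2, so it is enough
    to bound the values there. If values at positive elements p_n of bounded norm grew faster than
    n 2^(n+1), the family would be unbounded at the element dominating all
    the p_n. *)
Theorem posfun_uniform_bound (I : Type) (F : I -> posFunctional B) :
  (forall b, exists M, forall i, cabs (F i b) <= M) ->
  exists M, forall i b, rnorm b <= 1 -> cabs (F i b) <= M.
Proof.
move=> Fb.
have [M MP] : exists M, forall i x, pos_le2 x -> cabs (F i x) <= M.
  apply: contrapT => /forallNP nb.
  have bad (n : nat) : exists ix : I * B,
      pos_le2 ix.2 /\ n%:R * 2 ^+ n.+1 < cabs (F ix.1 ix.2).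
    have /existsNP[i /existsNP[x /not_implyP[xK lt]]] := nb (n%:R * 2 ^+ n.+1).
    by exists (i, x); split => //; rewrite ltNge; apply/negP.
  have [ix ixP] := choice bad.
  have [x xP] := pos_le2_dominated (fun n => (ixP n).1).
  have [M MP] := Fb x.
  pose n := (Num.trunc `|M|).+1.
  have Mn : M < n%:R by rewrite (le_lt_trans (ler_norm _)) // truncnS_gt.
  have [xK lt] := ixP n.
  have := ler_cabs (posfun_pos_le2 (F (ix n).1) xK) (xP (F (ix n).1) n).
  rewrite leNgt => /negP; apply; apply: le_lt_trans lt.
  have -> : 2 ^+ n.+1 = (2 ^+ n.+1 : R)%:C by rewrite rmorphXn rmorph_nat.
  rewrite cabsM cabs_real ger0_norm ?exprn_ge0 // mulrC.
  by rewrite ler_wpM2r ?exprn_ge0 // (le_trans (MP _)) // ltW.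
(* The factor 8 is 4 for the four positive parts of b / 2, and 2 for the scaling
   that makes the norm less than 1. *)
exists (8 * M) => i b b1.
have sa h : selfadj h -> rnorm h < 1 -> cabs (F i h) <= M + M.
  move=> hA /(selfadj_decomp hA)[p [q [pK qK ->]]].
  by rewrite linearB (le_trans (ler_cabsB _ _)) // lerD // MP.
pose b' := (2^-1 : R)%:C *: b.
have b'1 : rnorm b' < 1.
  by rewrite rnormZr ger0_norm ?invr_ge0 //; lra.
have re := sa _ (cre_selfadj b') (le_lt_trans (cre_norm _) b'1).
have im := sa _ (cim_selfadj b') (le_lt_trans (cim_norm _) b'1).
have -> : b = (2 : R)%:C *: (cre b' + iu *: cim b').
  by rewrite -cre_cim /b'; lincomb R[i]; field.
move: (cre b') (cim b') re im => h k hM kM.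
rewrite linearZ /= linearD /= linearZ /= cabsM cabs_real ger0_norm //.
have := ler_cabsD (F i h) (iu * F i k).
rewrite cabsM cabs_i mul1r; lra.
Qed.

(** * Unital algebras *)

Section Unital.
Context (e : B) (eU : is_unit e).

Lemma unit_selfadj : selfadj e.
Proof.
have [e1 _] := eU e^#.
by have := congr1 (@cstar R B) e1; rewrite cstarM cstarK e1.
Qed.

Lemma unit_norm : rnorm e <= 1.
Proof.
have [e1 _] := eU e; have := rnorm_sq unit_selfadj; rewrite e1 => e2.
by have := rnorm_ge0 e; nra.
Qed.

Lemma unit_sub_pos_le2 h : selfadj h -> rnorm h <= 1 -> pos_le2 (e - h).
Proof.
move=> hA h1; split; first by apply: selfadjB => //; exact: unit_selfadj.
move=> w; have [e1 _] := eU w.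
rewrite cmulBl e1 opprB addrC subrK (le_trans (rnormM _ _)) //.
by rewrite ler_piMl ?rnorm_ge0.
Qed.

Lemma posfun_unit_ge0 f : 0 <= f e.
Proof.
apply: posfun_ge0; exists e; rewrite unit_selfadj.
by have [-> _] := eU e.
Qed.

(** A scalar of modulus 1 makes the value at b nonnegative; it is then the
    value at the real part h of a multiple of b, and e - h is positive. *)
Lemma posfun_le_unit f b : rnorm b <= 1 -> cabs (f b) <= cabs (f e).
Proof.
move=> b1; have [f0|f0] := eqVneq (f b) 0.
  by rewrite f0 (_ : 0 = 0%:C) ?cabs_real ?normr0 ?cabs_ge0 // rmorph0.
pose s := `|f b| / f b.
have s1 : `|s| = 1 by rewrite normrM normrV ?unitfE // normr_id divff // normr_eq0.
have real h : selfadj h -> rnorm h <= 1 -> complex.Im (f h) = 0.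
  move=> hA h1; have := posfun_pos_le2 f (unit_sub_pos_le2 hA h1).
  rewrite linearB /= => /ger0_Im; have := ger0_Im (posfun_unit_ge0 f).
  by rewrite !raddfB /= => -> /eqP; rewrite sub0r oppr_eq0 => /eqP.
have sb1 : rnorm (s *: b) <= 1.
  by rewrite /rnorm normrZ s1 mul1r.
pose h := cre (s *: b); pose k := cim (s *: b).
have hA : selfadj h := cre_selfadj _; have h1 := le_trans (cre_norm (s *: b)) sb1.
have kA : selfadj k := cim_selfadj _; have k1 := le_trans (cim_norm (s *: b)) sb1.
have fsb : (cabs (f b))%:C = f h + iu * f k.
  have -> : (cabs (f b))%:C = f (s *: b) by rewrite linearZ /= -cabsE divfK.
  have fD (u v : B) : f (u + iu *: v) = f u + iu * f v.
    by rewrite linearD /= linearZ.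
  by rewrite -fD -cre_cim.
have fbh : cabs (f b) = complex.Re (f h).
  move: fsb (real _ kA k1); case: (f h) => hr hi; case: (f k) => kr ki /= E k0.
  by move: E; rewrite k0 => -[-> _]; rewrite !mul0r !mulr0 subrr addr0.
rewrite fbh; have := posfun_pos_le2 f (unit_sub_pos_le2 hA h1).
rewrite linearB /= subr_ge0 lecE => /andP[_ /le_trans]; apply.
exact: cabs_Re.
Qed.

Lemma functional_norm_unit f : functional_norm f = (cabs (f e))%:E.
Proof.
apply/eqP; rewrite eq_le; apply/andP; split.
  apply: ub_ereal_sup => _ [b /= b1 <-]; rewrite lee_fin.
  by apply: posfun_le_unit; rewrite -lecR -rnormE.
apply: ereal_sup_ubound; exists e => //=.
by rewrite rnormE lecR unit_norm.
Qed.

End Unital.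

End PositiveFunctionals.

(** * Hilbert spaces and the Riesz representation theorem *)

Section Riesz.
Context {R : realType} {H : hilbertType R}.
Implicit Types (h k x y z : H) (c : R[i]).
Local Notation "'<<' x , y '>>'" := (@inner R H x y).

Lemma innerDl x y z : <<x + y, z>> = <<x, z>> + <<y, z>>.
Proof. exact: linearDl. Qed.
Lemma innerNl x z : <<- x, z>> = - <<x, z>>.
Proof. exact: linearNl. Qed.
Lemma innerBl x y z : <<x - y, z>> = <<x, z>> - <<y, z>>.
Proof. exact: linearBl. Qed.
Lemma innerZl c x z : <<c *: x, z>> = c * <<x, z>>.
Proof. exact: linearZl_LR. Qed.
Lemma innerDr x y z : <<x, y + z>> = <<x, y>> + <<x, z>>.
Proof. exact: linearDr. Qed.
Lemma innerNr x z : <<x, - z>> = - <<x, z>>.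
Proof. exact: linearNr. Qed.
Lemma innerZr c x z : <<x, c *: z>> = c^* * <<x, z>>.
Proof. exact: linearZr_LR. Qed.

Lemma innerC x y : <<x, y>> = <<y, x>>^*.
Proof. by have := hermC (@inner R H) x y; rewrite expr0 mul1r. Qed.

Lemma inner_rnorm x : <<x, x>> = (rnorm x ^+ 2)%:C.
Proof. by rewrite inner_normE rnormE rmorphXn. Qed.

Lemma inner_ext x y : (forall z, <<x, z>> = <<y, z>>) -> x = y.
Proof.
move=> xy; apply/subr0_eq/rnorm_eq0/eqP; rewrite -sqrf_eq0; apply/eqP.
by apply: complexI; rewrite -inner_rnorm innerBl xy subrr.
Qed.

Lemma Re_innerC x y : complex.Re <<x, y>> = complex.Re <<y, x>>.
Proof. by rewrite innerC; case: (<<y, x>>). Qed.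

Lemma ReD c c' : complex.Re (c + c') = complex.Re c + complex.Re c'.
Proof. by case: c c' => ? ? []. Qed.

Lemma ReN c : complex.Re (- c) = - complex.Re c.
Proof. by case: c. Qed.

Lemma ReMr (s : R) c : complex.Re (s%:C * c) = s * complex.Re c.
Proof. by case: c => a b /=; rewrite mul0r subr0. Qed.

Lemma Re_inner_Zr (s : R) x y : complex.Re <<x, s%:C *: y>> = s * complex.Re <<x, y>>.
Proof. by rewrite Re_innerC innerZl ReMr Re_innerC. Qed.

Lemma rnorm_sqD x y :
  rnorm (x + y) ^+ 2 = rnorm x ^+ 2 + 2 * complex.Re <<x, y>> + rnorm y ^+ 2.
Proof.
have sqE z : rnorm z ^+ 2 = complex.Re <<z, z>> by rewrite inner_rnorm.
by rewrite !sqE innerDl !innerDr !ReD (Re_innerC y x); ring.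
Qed.

(** The discriminant of the quadratic polynomial in s is not positive. *)
Lemma discr_bound (a b m : R) : 0 <= a -> 0 <= m ->
  (forall s, 0 <= s ^+ 2 * a ^+ 2 + 2 * (s * b) + m ^+ 2) -> b <= a * m.
Proof.
move=> a0 m0 H0; rewrite leNgt; apply/negP => amb.
have b0 : 0 < b by rewrite (le_lt_trans _ amb) ?mulr_ge0.
have [a00|an0] := eqVneq a 0.
  have := H0 (- (m ^+ 2 / b)).
  rewrite a00 expr0n mulr0 add0r mulNr divfK ?gt_eqF // => h.
  have m00 : m ^+ 2 <= 0 by lra.
  have := H0 (-1); rewrite a00 expr0n mulr0; lra.
have a_gt0 : 0 < a by rewrite lt_neqAle eq_sym an0.
have := H0 (- (b / a ^+ 2)); rewrite leNgt => /negP; apply.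
have -> : (- (b / a ^+ 2)) ^+ 2 * a ^+ 2 + 2 * (- (b / a ^+ 2) * b) + m ^+ 2
    = m ^+ 2 - (b / a) ^+ 2 by field.
rewrite subr_lt0 ltr_sqr ?nnegrE // ?divr_ge0 ?ltW //.
by rewrite ltr_pdivlMr // mulrC.
Qed.

Lemma Re_inner_le x y : complex.Re <<x, y>> <= rnorm y * rnorm x.
Proof.
apply: discr_bound; rewrite ?rnorm_ge0 // => s.
have := sqr_ge0 (rnorm (x + s%:C *: y)).
rewrite rnorm_sqD Re_inner_Zr rnormZr exprMn real_normK ?num_real //.
lra.
Qed.

(** The factor 2 comes from estimating the real and imaginary parts apart. *)
Lemma cabs_inner_le x y : cabs <<x, y>> <= 2 * (rnorm x * rnorm y).
Proof.
have re z : `|complex.Re <<z, y>>| <= rnorm z * rnorm y.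
  rewrite ler_norml; apply/andP; split; last by rewrite mulrC Re_inner_le.
  by rewrite lerNl -ReN -innerNl mulrC -(rnormN z) Re_inner_le.
have -> : <<x, y>> = (complex.Re <<x, y>>)%:C + iu * (- complex.Re <<iu *: x, y>>)%:C.
  rewrite innerZl; case: (<<x, y>>) => a b; apply/eqP.
  by rewrite eq_complex /= !(mul0r, mul1r, mulr0, addr0, add0r, sub0r, subr0, opprK) !eqxx.
rewrite (le_trans (ler_cabsD _ _)) // cabsM cabs_i mul1r !cabs_real normrN.
have := re x; have := re (iu *: x); rewrite rnormZi; lra.
Qed.

(** The vector minimizes |x|^2 - 2 Re (g x); the parallelogram law makes a
    minimizing sequence converge. *)
Theorem riesz (g : H -> R[i]) (M : R) :
  (forall x y, g (x + y) = g x + g y) -> (forall c x, g (c *: x) = c^* * g x) ->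
  (forall x, cabs (g x) <= M * rnorm x) -> exists x, forall k, g k = <<x, k>>.
Proof.
move=> gD gZ gM.
have conjR (s : R) : (s%:C)^* = s%:C :> R[i] by rewrite conj_Creal // complex_real.
pose F x := rnorm x ^+ 2 - 2 * complex.Re (g x).
have F_ge x : - M ^+ 2 <= F x.
  have := le_trans (cabs_Re _) (gM x); have := sqr_ge0 (rnorm x - M).
  rewrite /F; lra.
pose A := [set F x | x in [set: H]]%classic.
have infA : has_inf A.
  split; first by exists (F 0); exists 0.
  by exists (- M ^+ 2) => _ [x _ <-].
pose m := inf A.
have mF x : m <= F x by apply: ge_inf; [exact: infA.2 | exists x].
have u_ex n : exists x, F x <= m + n.+1%:R^-1 ^+ 2.
  have e0 : 0 < n.+1%:R^-1 ^+ 2 :> R by rewrite exprn_gt0 // invr_gt0 ltr0n.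
  have [_ [x _ <-] lt] := inf_adherent e0 infA.
  by exists x; exact: ltW.
have [u uP] := choice u_ex.
have Fmid x y : rnorm (x - y) ^+ 2 = 2 * (F x + F y - 2 * F ((2^-1 : R)%:C *: (x + y))).
  rewrite /F gZ gD conjR ReMr ReD rnormZr exprMn real_normK ?num_real //.
  rewrite !rnorm_sqD rnormN innerNr ReN.
  by field.
have ud n (k : nat) : (n <= k)%N -> rnorm (u k - u n) <= 2 / n.+1%:R.
  move=> nk; rewrite -ler_sqr ?nnegrE ?rnorm_ge0 ?divr_ge0 // Fmid.
  have := uP n; have := uP k; have := mF ((2^-1 : R)%:C *: (u k + u n)).
  have : k.+1%:R^-1 ^+ 2 <= n.+1%:R^-1 ^+ 2 :> R.
    by rewrite lerXn2r ?nnegrE ?invr_ge0 // lef_pV2 ?posrE ?ltr0n // ler_nat.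
  set a := n.+1%:R^-1; set b := k.+1%:R^-1; rewrite exprMn; lra.
have [x xu] := complete_rate ud.
have re k : complex.Re <<x, k>> <= complex.Re (g k).
  apply: (@ler_rate _ _ _ (3 * rnorm k)) => n.
  (* The value of F at u n is nearly minimal, so by comparison with its values
     at u n + s k its derivative along k is nearly 0. *)
  have un : complex.Re <<u n, k>> - complex.Re (g k) <= rnorm k * n.+1%:R^-1.
    apply: discr_bound; rewrite ?rnorm_ge0 // => s.
    have := mF (u n + s%:C *: k); have := uP n.
    rewrite /F rnorm_sqD Re_inner_Zr rnormZr exprMn real_normK ?num_real //.
    by rewrite gD gZ conjR ReD ReMr; set a := n.+1%:R^-1; lra.
  have := Re_inner_le (x - u n) k; rewrite innerBl ReD ReN.
  have := ler_wpM2l (rnorm_ge0 k) (xu n); rewrite rnormBC.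
  move: un; set a := n.+1%:R^-1; lra.
have reE k : complex.Re <<x, k>> = complex.Re (g k).
  apply/le_anti; rewrite re /=; have := re (- k).
  have gN : g (- k) = - g k by rewrite -scaleN1r gZ rmorphN rmorph1 mulN1r.
  by rewrite innerNr gN !ReN lerN2.
exists x => k; apply/eqP; rewrite eq_complex reE eqxx /=.
have := reE (iu *: k); rewrite innerZr gZ complexiE conjCi -complexiE.
case: (<<x, k>>) => a b; case: (g k) => a' b' /=.
by rewrite !(mul0r, mulN1r, oppr0, sub0r, opprK, mul1r) => ->.
Qed.

End Riesz.

(** * Quadratic forms and polarization *)

Section AdditiveMaps.
Context {R : realType}.

(** The values at integers are 0, so the map is periodic with period 1, hence
    bounded, and a bounded additive map is zero. *)
Lemma additive_bounded_eq0 (phi : R -> R[i]) (K : R) :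
  (forall s t, phi (s + t) = phi s + phi t) -> phi 1 = 0 ->
  (forall s, 0 <= s <= 1 -> cabs (phi s) <= K) -> forall s, phi s = 0.
Proof.
move=> phiD phi1 phiK.
have phi0 : phi 0 = 0 by apply: (addrI (phi 0)); rewrite -phiD !addr0.
have phiN s : phi (- s) = - phi s.
  by apply: (addrI (phi s)); rewrite -phiD !subrr.
have phin n s : phi (n%:R * s) = n%:R * phi s.
  elim: n => [|n IHn]; first by rewrite !mul0r.
  by rewrite -!natr1 !mulrDl phiD IHn !mul1r.
suff pos s : 0 <= s -> phi s = 0.
  move=> s; have [/pos//|/ltW s0] := leP 0 s.
  by rewrite -(opprK s) phiN pos ?oppr0 // oppr_ge0.
move=> s0.
suff c0 : cabs (phi s) <= 0.
  have {}c0 : cabs (phi s) = 0 by apply/le_anti; rewrite c0 cabs_ge0.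
  by apply/eqP; rewrite -normr_eq0 cabsE c0.
apply: (@ler_rate _ _ _ K) => n; rewrite add0r ler_pdivlMr ?ltr0n //.
have nE : n.+1%:R = (n.+1%:R : R)%:C by rewrite rmorph_nat.
have -> : cabs (phi s) * n.+1%:R = cabs (phi (n.+1%:R * s)).
  by rewrite phin nE cabsM cabs_real normr_nat mulrC.
have ns0 : 0 <= n.+1%:R * s by rewrite mulr_ge0.
have /andP[t1 t2] := truncn_itv ns0.
set t := n.+1%:R * s in t1 t2 *; set k := Num.trunc t in t1 t2.
rewrite -(subrK (k%:R : R) t) phiD -[k%:R]mulr1 phin phi1 mulr0 addr0 mulr1.
apply: phiK; rewrite subr_ge0 t1 lerBlDr addrC natr1; exact: ltW.
Qed.

End AdditiveMaps.

Section Polarization.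
Context {R : realType} {H : hilbertType R}.
Implicit Types (h k x y z : H) (c : R[i]).
Local Notation "'<<' x , y '>>'" := (@inner R H x y).

Definition diff_form (q : H -> R[i]) h k := q (h + k) - q (h - k).

Definition polar (q : H -> R[i]) h k : R[i] :=
  4^-1 * (diff_form q h k + iu * diff_form q h (iu *: k)).

Section Form.
Context (q : H -> R[i]) (M : R).
Context (qZ : forall c h, q (c *: h) = `|c| ^+ 2 * q h).
Context (qD : forall h k, q (h + k) + q (h - k) = 2 * q h + 2 * q k).
Context (qM : forall h, cabs (q h) <= M * rnorm h ^+ 2).
Local Notation P := (diff_form q).

Lemma qform_N h : q (- h) = q h.
Proof. by rewrite -scaleN1r qZ normrN1 expr1n mul1r. Qed.

Lemma qform_i h : q (iu *: h) = q h.
Proof. by rewrite qZ cabsE cabs_i expr1n mul1r. Qed.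

Lemma diff_formC h k : P h k = P k h.
Proof. by rewrite /diff_form (addrC k h) -(opprB h k) qform_N. Qed.

Lemma diff_form0l k : P 0 k = 0.
Proof. by rewrite /diff_form add0r sub0r qform_N subrr. Qed.

(** By the parallelogram law at the midpoint of x and y, the sum of the values
    at x and y is twice the value at the midpoint; take y = 0. *)
Lemma diff_formDl x y z : P (x + y) z = P x z + P y z.
Proof.
have mid u v : P u z + P v z = 2 * P ((2^-1 : R)%:C *: (u + v)) z.
  set a := (2^-1 : R)%:C *: (u + v); set b := (2^-1 : R)%:C *: (u - v).
  have uE : u = a + b by rewrite /a /b; lincomb R[i]; field.
  have vE : v = a - b by rewrite /a /b; lincomb R[i]; field.
  have e1 := qD (a + z) b; have e2 := qD (a - z) b.
  rewrite /diff_form uE vE (addrAC a b z) (addrAC a (- b) z).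
  rewrite (addrAC a b (- z)) (addrAC a (- b) (- z)).
  rewrite addrACA e1 -opprD e2; ring.
have := mid (x + y) 0; rewrite diff_form0l !addr0 => ->.
by rewrite -mid.
Qed.

Lemma diff_formDr x y z : P z (x + y) = P z x + P z y.
Proof. by rewrite !(diff_formC z) diff_formDl. Qed.

Lemma diff_formNl x z : P (- x) z = - P x z.
Proof.
by apply: (addrI (P x z)); rewrite -diff_formDl !subrr diff_form0l.
Qed.

Lemma diff_form_bound0 h k : 0 <= M ->
  cabs (P h k) <= 2 * M * (rnorm h + rnorm k) ^+ 2.
Proof.
move=> M0; rewrite (le_trans (ler_cabsB _ _)) //.
have bound x : rnorm x <= rnorm h + rnorm k ->
    cabs (q x) <= M * (rnorm h + rnorm k) ^+ 2.
  move=> xb; rewrite (le_trans (qM _)) // ler_wpM2l //.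
  by rewrite ler_sqr ?nnegrE ?addr_ge0 ?rnorm_ge0.
have := bound _ (ler_rnormD h k); have := bound _ (ler_rnormB h k); lra.
Qed.

(** As a function of s, the difference of the two sides is additive and bounded
    on [0, 1]. *)
Lemma diff_formZl (s : R) h k : 0 <= M -> P (s%:C *: h) k = s%:C * P h k.
Proof.
move=> M0; apply: subr0_eq.
pose phi (t : R) := P (t%:C *: h) k - t%:C * P h k.
apply: (@additive_bounded_eq0 _ phi
  (2 * M * (rnorm h + rnorm k) ^+ 2 + cabs (P h k))) => [t u||t /andP[t0 t1]].
- by rewrite /phi rmorphD scalerDl diff_formDl; ring.
- by rewrite /phi rmorph1 scale1r mul1r subrr.
- rewrite /phi (le_trans (ler_cabsB _ _)) // lerD //.
    rewrite (le_trans (diff_form_bound0 _ _ M0)) // ler_wpM2l ?mulr_ge0 //.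
    rewrite ler_sqr ?nnegrE ?addr_ge0 ?rnorm_ge0 // lerD // rnormZr ger0_norm //.
    by rewrite ler_piMl // rnorm_ge0.
  by rewrite cabsM cabs_real ger0_norm // ler_piMl // cabs_ge0.
Qed.

Lemma diff_formZr (s : R) h k : 0 <= M -> P h (s%:C *: k) = s%:C * P h k.
Proof. by move=> M0; rewrite diff_formC diff_formZl // diff_formC. Qed.

(** By homogeneity the bound need only be known for unit vectors. *)
Lemma diff_form_bound h k : 0 <= M -> cabs (P h k) <= 8 * M * (rnorm h * rnorm k).
Proof.
move=> M0.
have unit x : rnorm x != 0 -> exists2 y, x = (rnorm x)%:C *: y & rnorm y = 1.
  move=> x0; exists ((rnorm x)^-1%:C *: x).
    by rewrite scalerA -rmorphM divff // rmorph1 scale1r.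
  by rewrite rnormZr ger0_norm ?invr_ge0 ?rnorm_ge0 // mulVf.
have cabs0 : cabs (0 : R[i]) = 0 by rewrite /cabs normr0.
have [h0|/unit[y hE y1]] := eqVneq (rnorm h) 0.
  by rewrite (rnorm_eq0 h0) diff_form0l cabs0 rnorm0 mul0r mulr0.
have [k0|/unit[z kE z1]] := eqVneq (rnorm k) 0.
  by rewrite (rnorm_eq0 k0) diff_formC diff_form0l cabs0 rnorm0 !mulr0.
rewrite {1}hE {1}kE diff_formZl // diff_formZr // !cabsM !cabs_real.
rewrite !ger0_norm ?rnorm_ge0 // mulrA [leLHS]mulrC.
rewrite ler_wpM2r ?mulr_ge0 ?rnorm_ge0 //.
by have := diff_form_bound0 y z M0; rewrite y1 z1; lra.
Qed.

Lemma diff_form_ii h k : P (iu *: h) (iu *: k) = P h k.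
Proof. by rewrite /diff_form -scalerDr -scalerBr !qform_i. Qed.

Lemma scaleii x : iu *: (iu *: x) = - x.
Proof. by rewrite scalerA -expr2 sqr_i scaleN1r. Qed.

Lemma diff_form_il h k : P (iu *: h) k = - P h (iu *: k).
Proof. by rewrite -diff_form_ii scaleii diff_formNl. Qed.

Lemma polarDl x y z : polar q (x + y) z = polar q x z + polar q y z.
Proof. by rewrite /polar !diff_formDl; ring. Qed.

Lemma polarDr x y z : polar q z (x + y) = polar q z x + polar q z y.
Proof. by rewrite /polar scalerDr !diff_formDr; ring. Qed.

Lemma polarZl c x z : 0 <= M -> polar q (c *: x) z = c * polar q x z.
Proof.
move=> M0; have i2 : iu * iu = -1 :> R[i] by rewrite -expr2 sqr_i.
have -> : c *: x = (complex.Re c)%:C *: x + (complex.Im c)%:C *: (iu *: x).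
  by rewrite scalerA -scalerDl mulrC -complexE.
rewrite {3}[c]complexE /polar !diff_formDl !diff_formZl // !diff_form_il.
rewrite scaleii [P x (- z)]diff_formC diff_formNl (diff_formC z).
by ring: i2.
Qed.

Lemma polarZr c x z : 0 <= M -> polar q x (c *: z) = c^* * polar q x z.
Proof.
move=> M0; have i2 : iu * iu = -1 :> R[i] by rewrite -expr2 sqr_i.
have -> : c *: z = (complex.Re c)%:C *: z + (complex.Im c)%:C *: (iu *: z).
  by rewrite scalerA -scalerDl mulrC -complexE.
have -> : c^* = (complex.Re c)%:C - iu * (complex.Im c)%:C.
  case: c => a b; apply/eqP; rewrite eq_complex /=.
  by rewrite !(mul0r, mul1r, mulr0, addr0, add0r, sub0r, subr0, oppr0) !eqxx.
have swap (s : R) y : iu *: (s%:C *: y) = s%:C *: (iu *: y).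
  by rewrite !scalerA mulrC.
rewrite /polar scalerDr !swap !diff_formDr !diff_formZr // scaleii.
rewrite [P x (- z)]diff_formC diff_formNl (diff_formC z).
by ring: i2.
Qed.

Lemma polar_diag h : polar q h h = q h.
Proof.
have q2 : q (h + h) = 4 * q h.
  have -> : h + h = 2%:C *: h by rewrite rmorph_nat scaler_nat mulr2n.
  by rewrite qZ cabsE cabs_real ger0_norm // -rmorphXn -natrX rmorph_nat.
have ih : P h (iu *: h) = 0.
  rewrite /diff_form -[X in X - _]qform_i scalerDr scaleii.
  by rewrite -(opprB h) qform_N subrr.
rewrite /polar ih mulr0 addr0 /diff_form subrr q2.
have -> : q 0 = 0 by rewrite -(scale0r h) qZ normr0 expr0n mul0r.
by rewrite subr0 mulKf ?pnatr_eq0.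
Qed.

Lemma polar_bound h k : 0 <= M ->
  cabs (polar q h k) <= 4 * M * (rnorm h * rnorm k).
Proof.
move=> M0.
have E : 4^-1 = (4^-1 : R)%:C :> R[i] by rewrite fmorphV rmorph_nat.
rewrite /polar E cabsM cabs_real ger0_norm ?invr_ge0 // ler_pdivrMl //.
rewrite (le_trans (ler_cabsD _ _)) // cabsM cabs_i mul1r.
have := diff_form_bound h k M0; have := diff_form_bound h (iu *: k) M0.
rewrite rnormZi; lra.
Qed.

Theorem qform_operator : 0 <= M ->
  exists T : H -> H, [/\ linear T,
    forall h, rnorm (T h) <= 4 * M * rnorm h &
    forall h k, <<T h, k>> = polar q h k].
Proof.
move=> M0.
have T_ex h : exists x, forall k, polar q h k = <<x, k>>.
  apply: (@riesz _ _ _ (4 * M * rnorm h)) => [x y|c x|x].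
  - exact: polarDr.
  - exact: polarZr.
  - by rewrite -mulrA; exact: polar_bound.
have [T TP] := choice T_ex; exists T; split.
- move=> c x y; apply: inner_ext => z.
  by rewrite innerDl innerZl -!TP polarDl polarZl.
- move=> h; have [T0|T0] := eqVneq (rnorm (T h)) 0.
    by rewrite T0 !mulr_ge0 // rnorm_ge0.
  have T_gt0 : 0 < rnorm (T h) by rewrite lt_neqAle eq_sym T0 rnorm_ge0.
  rewrite -(ler_pM2r T_gt0) -expr2.
  have -> : rnorm (T h) ^+ 2 = cabs <<T h, T h>>.
    by rewrite inner_rnorm cabs_real ger0_norm ?sqr_ge0.
  by rewrite -TP -[leRHS]mulrA; exact: polar_bound.
- by move=> h k; rewrite TP.
Qed.

End Form.

(** In particular an operator is determined by its quadratic form. *)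
Lemma inner_polar (T : H -> H) h k : linear T ->
  <<T h, k>> = polar (fun x => <<T x, x>>) h k.
Proof.
move=> Tl.
have TD x y : T (x + y) = T x + T y by have := Tl 1 x y; rewrite !scale1r.
have T0 : T 0 = 0 by apply: (addrI (T 0)); rewrite -TD !addr0.
have TZ c x : T (c *: x) = c *: T x by have := Tl c x 0; rewrite !addr0 T0 addr0.
have TN x : T (- x) = - T x by rewrite -scaleN1r TZ scaleN1r.
have i2 : iu * iu = -1 :> R[i] by rewrite -expr2 sqr_i.
have iC : (iu : R[i])^* = - iu by rewrite complexiE conjCi.
rewrite /polar /diff_form !TD !TN !TZ !innerDl !innerNl !innerDr !innerNr.
rewrite !innerZl !innerZr iC.
by field: i2.
Qed.

End Polarization.

(** * Positive maps and families of positive functionals *)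

Section PositiveMaps.
Context {R : realType} {B : cstarAlgType R} {H : hilbertType R}.
Local Notation "'<<' x , y '>>'" := (@inner R H x y).

Lemma bop_linear (T : boundedOp H) : linear T.
Proof. by have /asboolP[] := bop_bounded T. Qed.

Lemma bop_rnorm (T : boundedOp H) :
  exists2 M, 0 <= M & forall h, rnorm (T h) <= M * rnorm h.
Proof.
have /asboolP[_ [M TM]] := bop_bounded T.
exists (cabs M) => [|h]; first exact: cabs_ge0.
have := TM h; rewrite !rnormE lecE => /andP[_ /=]; rewrite mulrC ReMr.
by move/le_trans; apply; rewrite mulrC ler_wpM2r ?rnorm_ge0 // cabs_Re.
Qed.

Lemma functional_norm_leP (f : B -> R[i]) (C : R) :
  (functional_norm f <= C%:E)%E <-> forall b, rnorm b <= 1 -> cabs (f b) <= C.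
Proof.
split=> [fC b b1|fC].
  rewrite -lee_fin (le_trans _ fC) //; apply: ereal_sup_ubound; exists b => //=.
  by rewrite rnormE -(rmorph1 (real_complex R)) lecR.
apply: ub_ereal_sup => _ [b /= b1 <-]; rewrite lee_fin fC //.
by rewrite -lecR -rnormE.
Qed.

Lemma functional_norm_bound (f : {scalar B}) (C : R) :
  (functional_norm f <= C%:E)%E -> forall b, cabs (f b) <= C * rnorm b.
Proof.
move=> /functional_norm_leP fC b; have [b0|b0] := eqVneq (rnorm b) 0.
  by rewrite (rnorm_eq0 b0) linear0 rnorm0 mulr0 /cabs normr0.
have b_gt0 : 0 < rnorm b by rewrite lt_neqAle eq_sym b0 rnorm_ge0.
rewrite -ler_pdivrMr // mulrC.
have -> : (rnorm b)^-1 * cabs (f b) = cabs (f ((rnorm b)^-1%:C *: b)).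
  by rewrite linearZ /= cabsM cabs_real ger0_norm // invr_ge0 ltW.
by apply: fC; rewrite rnormZr ger0_norm ?invr_ge0 ?rnorm_ge0 // mulVf.
Qed.

Section QuadraticFamily.
Context (Phi : {linear B -> boundedOp H}) (gamma : H -> posFunctional B).
Context (gammaE : forall (b : B) (h : H), gamma h b = <<Phi b h, h>>).

Lemma inner_map_scale c h b : gamma (c *: h) b = `|c| ^+ 2 * gamma h b.
Proof.
have PZ x : Phi b (c *: x) = c *: Phi b x.
  have Pl := bop_linear (Phi b); have P0 : Phi b 0 = 0.
    by have := Pl (-1) 0 0; rewrite !scaleN1r oppr0 addr0 addNr.
  by have := Pl c x 0; rewrite P0 !addr0.
by rewrite !gammaE PZ innerZl innerZr mulrA -normCK.
Qed.

Lemma inner_map_parallelogram h k b :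
  gamma (h + k) b + gamma (h - k) b = 2 * gamma h b + 2 * gamma k b.
Proof.
have PD x y : Phi b (x + y) = Phi b x + Phi b y.
  by have := bop_linear (Phi b) 1 x y; rewrite !scale1r.
have PN x : Phi b (- x) = - Phi b x.
  have P0 : Phi b 0 = 0 by apply: (addrI (Phi b 0)); rewrite -PD !addr0.
  by apply: (addrI (Phi b x)); rewrite -PD !subrr.
rewrite !gammaE !PD PN !(innerDl, innerDr, innerNl, innerNr); ring.
Qed.

(** The functionals at the vectors of the unit ball are pointwise bounded,
    each operator being bounded; hence they are uniformly bounded. *)
Lemma inner_map_bounded : exists C : R, forall h,
  (functional_norm (gamma h) <= (C * rnorm h ^+ 2)%:E)%E.
Proof.
pose ball := {h : H | rnorm h <= 1}.
have [C CP] : exists C, forall (i : ball) b, rnorm b <= 1 ->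
    cabs (gamma (sval i) b) <= C.
  apply: (posfun_uniform_bound (F := fun i : ball => gamma (sval i))) => b.
  have [M M0 MP] := bop_rnorm (Phi b); exists (2 * M) => -[h h1] /=.
  rewrite gammaE (le_trans (cabs_inner_le _ _)) // ler_wpM2l //.
  have := rnorm_ge0 h; have := rnorm_ge0 (Phi b h); have := MP h; nra.
exists C => h; apply/functional_norm_leP => b b1.
have [h0|h0] := eqVneq (rnorm h) 0.
  rewrite h0 expr0n mulr0 (rnorm_eq0 h0) -(scale0r (0 : H)) inner_map_scale.
  by rewrite normr0 expr0n mul0r /cabs normr0.
pose k := (rnorm h)^-1%:C *: h.
have k1 : rnorm k <= 1.
  by rewrite rnormZr ger0_norm ?invr_ge0 ?rnorm_ge0 // mulVf.
have -> : h = (rnorm h)%:C *: k.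
  by rewrite /k scalerA -rmorphM divff // rmorph1 scale1r.
rewrite inner_map_scale cabsE cabs_real ger0_norm ?rnorm_ge0 //.
rewrite cabsM -rmorphXn cabs_real ger0_norm ?sqr_ge0 // mulrC.
rewrite rnormZr ger0_norm ?rnorm_ge0 // /k rnormZr ger0_norm ?invr_ge0 ?rnorm_ge0 //.
by rewrite mulVf // mulr1 ler_wpM2r ?sqr_ge0 // (CP (exist _ k k1)).
Qed.

Lemma map_unit_iff e : is_unit e ->
  (forall h, Phi e h = h) <-> (forall h, `|h| = 1 -> is_state (gamma h)).
Proof.
move=> eU; split=> [Pe h h1|st h].
  rewrite /is_state (functional_norm_unit eU) gammaE Pe inner_normE h1.
  by rewrite expr1n /cabs normr1.
have unit k : `|k| = 1 -> gamma k e = 1.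
  move=> k1; have := st _ k1; rewrite /is_state (functional_norm_unit eU) => -[c1].
  by rewrite (ge0_cabs (posfun_unit_ge0 eU _)) c1 rmorph1.
have gE k : <<Phi e k, k>> = <<k, k>>.
  rewrite -gammaE; have [->|k0] := eqVneq k 0.
    rewrite -(scale0r (0 : H)) inner_map_scale normr0 expr0n mul0r scale0r.
    by rewrite inner_normE normr0 expr0n.
  have nk0 : `|k| != 0 by rewrite normr_eq0.
  have kE : k = `|k| *: (`|k|^-1 *: k) by rewrite scalerA divff // scale1r.
  rewrite {1}kE inner_map_scale unit ?mulr1; first by rewrite normr_id inner_normE.
  by rewrite normrZ normrV ?unitfE // normr_id mulVf.
apply: inner_ext => k.
rewrite (inner_polar _ _ (bop_linear (Phi e))).
have -> : (fun x => <<Phi e x, x>>) = (fun x => <<x, x>>) by apply/funext.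
by rewrite -(@inner_polar _ _ id).
Qed.

End QuadraticFamily.

(** Each quadratic form h -> gamma h b comes from a bounded operator, and
    polarization makes the operator depend linearly on b. *)
Lemma quadratic_family_map (gamma : H -> posFunctional B) (C : R) :
  (forall c h b, gamma (c *: h) b = `|c| ^+ 2 * gamma h b) ->
  (forall h, (functional_norm (gamma h) <= (C * rnorm h ^+ 2)%:E)%E) ->
  (forall h k b,
     gamma (h + k) b + gamma (h - k) b = 2 * gamma h b + 2 * gamma k b) ->
  exists Phi : {linear B -> boundedOp H},
    positive_map Phi /\ forall b h, gamma h b = <<Phi b h, h>>.
Proof.
move=> gZ gC gD.
have gM b h : cabs (gamma h b) <= (`|C| * rnorm b) * rnorm h ^+ 2.
  apply: le_trans (functional_norm_bound (gC h) b) _.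
  by rewrite mulrAC ler_wpM2r ?sqr_ge0 // ler_wpM2r ?rnorm_ge0 // ler_norm.
have T_ex b : exists T : boundedOp H, forall h k,
    <<T h, k>> = polar (fun x => gamma x b) h k.
  have Cb : 0 <= `|C| * rnorm b by rewrite mulr_ge0 ?rnorm_ge0.
  have [T [Tl Tb TP]] := qform_operator (fun c h => gZ c h b)
    (fun h k => gD h k b) (gM b) Cb.
  have Tbop : T \in @bounded_operator R H.
    apply/asboolP; split=> //; exists (4 * (`|C| * rnorm b))%:C => h.
    by rewrite !rnormE -rmorphM lecR.
  by exists (BoundedOp Tbop).
have [Phi PhiP] := choice T_ex.
have PhiL : linear Phi.
  move=> a b c; apply: val_inj; apply/funext => h; apply: inner_ext => k.
  rewrite PhiP; have -> : val (a *: Phi b + Phi c) h = a *: Phi b h + Phi c h by [].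
  have gl x : gamma x (a *: b + c) = a * gamma x b + gamma x c by rewrite linearP.
  by rewrite innerDl innerZl !PhiP /polar /diff_form !gl; ring.
pose L := GRing.isLinear.Build R[i] B (boundedOp H) *:%R Phi PhiL.
pose PhiLin : {linear B -> boundedOp H} := HB.pack Phi L.
exists PhiLin.
have E b h : gamma h b = <<PhiLin b h, h>>.
  by rewrite PhiP (polar_diag (q := fun x => gamma x b)).
split=> // a a0 h.
by rewrite -E; exact: posfun_ge0.
Qed.

End PositiveMaps.

Theorem theorem3p5 (R : realType) (B : cstarAlgType R) (H : hilbertType R)
    (gamma : H -> posFunctional B) :
  ((exists Phi : {linear B -> boundedOp H},
      positive_map Phi /\
      forall (b : B) (h : H), gamma h b = inner (Phi b h) h)
   <->
   [/\ (forall (lambda : R[i]) (h : H) (b : B),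
          gamma (lambda *: h) b = `|lambda| ^+ 2 * gamma h b),
       (exists C : R, forall h : H,
          (functional_norm (gamma h) <= (C * complex.Re `|h| ^+ 2)%:E)%E) &
       (forall (h k : H) (b : B),
          gamma (h + k) b + gamma (h - k) b
            = 2 * gamma h b + 2 * gamma k b)])
  /\
  (forall Phi : {linear B -> boundedOp H},
     positive_map Phi ->
     (forall (b : B) (h : H), gamma h b = inner (Phi b h) h) ->
     forall e : B, is_unit e ->
       ((forall h : H, Phi e h = h)
        <-> (forall h : H, `|h| = 1 -> is_state (gamma h)))).
Proof.
split; last first.
  by move=> Phi _ gammaE e eU; exact: (map_unit_iff gammaE eU).
split=> [[Phi [_ gammaE]]|[gZ [C gC] gD]].
  split.
  - exact: (inner_map_scale gammaE).
  - exact: (inner_map_bounded gammaE).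
  - exact: (inner_map_parallelogram gammaE).
exact: (quadratic_family_map gZ gC gD).
Qed.
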